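(* Suppose the stepsizes are $\alpha_k=\frac{\theta}{\mu(k+K)}$ for all $k\ge 0$ with $\theta>2$ and $K=\left\lceil\frac{2\theta(1+M)L^2}{\mu^2}\right\rceil$, and let $K_1=\left\lceil\max\left\{2K,\frac{16}{1-\rho_w^2}\right\}\right\rceil$ and $\tilde k=k+K$. Then for all $k\ge K_1-K$, $$\mathbb{E}\left[\|\overline{x}(k)-x_*\|^2\right]\le\frac{\theta^2c_2}{(1.5\theta-1)n\mu^2\tilde k}+\frac{c}{\tilde k^2},\qquad\text{where } c=\mathcal{O}\left(\frac{A+B+n}{n(1-\rho_w)^2}\right).$$
   Context: Objectives: $n,p,m\ge 1$ are integers and $\mathcal N=\{1,\dots,n\}$. Each $f_i:\mathbb{R}^p\to\mathbb{R}$, $i\in\mathcal N$, is differentiable, $\mu$-strongly convex with $L$-Lipschitz gradient ($\mu,L>0$): $\langle\nabla f_i(x)-\nabla f_i(x'),x-x'\rangle\ge\mu\|x-x'\|^2$ and $\|\nabla f_i(x)-\nabla f_i(x')\|\le L\|x-x'\|$ for all $x,x'$. Let $f=\frac1n\sum_i f_i$; $x_*$ is its unique minimizer. Network: the agents interact over an undirected connected graph on $\mathcal N$. The mixing matrix $\mathbf W=[w_{ij}]\in\mathbb{R}^{n\times n}$ is nonnegative, satisfies $w_{ij},w_{ji}>0$ if $i,j$ are connected by an edge and $w_{ij}=w_{ji}=0$ otherwise ($i\ne j$), and is doubly stochastic: $\mathbf W\mathbf 1=\mathbf 1$, $\mathbf 1^\top\mathbf W=\mathbf 1^\top$. $\rho_w$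 is the spectral norm of $\mathbf W-\frac1n\mathbf 1\mathbf 1^\top$, and $\rho_w<1$. Algorithm (DSGD): from arbitrary deterministic $x_i(0)\in\mathbb{R}^p$, $x_i(k+1)=\sum_{j=1}^n w_{ij}\left(x_j(k)-\alpha_k g_j(k)\right)$, $k\ge0$, where $g_j(k)=g_j(x_j(k),\xi_j(k))\in\mathbb{R}^p$ and $\xi_j(k)$ are random vectors in $\mathbb{R}^m$. Noise: let $\mathcal F(k)$ be the $\sigma$-algebra generated by $\{x_i(0),\dots,x_i(k): i\in\mathcal N\}$. For every $k\ge0$ the vectors $\xi_1(k),\dots,\xi_n(k)$ are independent across $i$ conditionally on $\mathcal F(k)$, $\mathbb{E}[g_i(k)\mid\mathcal F(k)]=\nabla f_i(x_i(k))$, and $\mathbb{E}[\|g_i(k)-\nabla f_i(x_i(k))\|^2\mid\mathcal F(k)]\le\sigma^2+M\|\nabla f_i(x_i(k))\|^2$ for some constants $\sigma,M>0$. Notation: $\overline{x}(k)=\frac1n\sum_i x_i(k)$, $A=\sum_{i=1}^n\|x_i(0)-x_*\|^2$, $B=\sum_{i=1}^n\|\nabla f_i(x_* )\|^2$, $\bar M=\frac{2MB}{n}+\sigma^2$, $\hat X=\max\left\{A,\frac{9B}{\mu^2}+\frac{n\sigma^2}{(1+M)L^2}\right\}$, $c_2=\frac{2ML^2}{n}\hat X+\bar M$. $\mathcal{O}(\cdot)$ hides constants depending only on $\theta,\mu,L,\sigma,M$ (not on $k,n,p,\rho_w,A,B$). *)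

(* Defs.v *)
From HB Require Import structures.
From mathcomp Require Export all_boot all_order all_algebra.
From mathcomp Require Export all_classical all_reals all_analysis.

Set Implicit Arguments.
Unset Strict Implicit.
Unset Printing Implicit Defensive.

Export Order.TTheory GRing.Theory Num.Theory.
Export numFieldNormedType.Exports.

Local Open Scope classical_set_scope.
Local Open Scope ring_scope.

(* R^q is 'rV[R]_q, measured by the sigma-algebra generated by the coordinates,
   that is, by the Borel sets of R^q. *)
Section measurable_row_vector.
Context {R : realType} {q : nat}.

Let coord (i : 'I_q) (u : 'rV[R]_q) : R := u 0 i.

Let coord_set0 : g_sigma_preimage coord set0.
Proof. exact: sigma_algebra0. Qed.

Let coord_setC A : g_sigma_preimage coord A -> g_sigma_preimage coord (~` A).
Proof. exact: sigma_algebraC. Qed.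

Let coord_bigcup (F : (set 'rV[R]_q)^nat) :
  (forall i, g_sigma_preimage coord (F i)) ->
  g_sigma_preimage coord (\bigcup_i F i).
Proof. exact: sigma_algebra_bigcup. Qed.

HB.instance Definition _ := @isMeasurable.Build
  (sigma_display (\big[setU/set0]_(i < q)
    preimage_set_system setT (coord i) measurable))
  'rV[R]_q (g_sigma_preimage coord) coord_set0 coord_setC coord_bigcup.

End measurable_row_vector.

(* The library norm `|u| on row vectors is the sup norm, hence a separate
   Euclidean norm. *)
Definition dotp {R : realType} {q : nat} (u v : 'rV[R]_q) : R :=
  \sum_(i < q) u 0 i * v 0 i.

Definition enorm {R : realType} {q : nat} (u : 'rV[R]_q) : R :=
  Num.sqrt (dotp u u).

(* Operator norm of A induced by the Euclidean norm; rows are used as vectors,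
   so that v *m A^T is A applied to v. *)
Definition spectral_norm {R : realType} {q : nat} (A : 'M[R]_q) : R :=
  sup [set enorm (v *m A^T) | v in [set v : 'rV[R]_q | enorm v <= 1]].

Definition gradient {R : realType} {q : nat} (h : 'rV[R]_q -> R)
    (u : 'rV[R]_q) : 'rV[R]_q :=
  \row_(j < q) 'D_(delta_mx 0 j) h u.

Section objectives.
Context {R : realType} {n p : nat}.
Implicit Type f : 'I_n -> 'rV[R]_p -> R.

Definition strongly_convex_smooth (mu L : R) (h : 'rV[R]_p -> R) : Prop :=
  [/\ forall u, differentiable h u,
      forall u v, mu * enorm (u - v) ^+ 2 <=
                  dotp (gradient h u - gradient h v) (u - v)
    & forall u v, enorm (gradient h u - gradient h v) <= L * enorm (u - v)].

Definition average (v : 'I_n -> 'rV[R]_p) : 'rV[R]_p :=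
  n%:R^-1 *: \sum_(i < n) v i.

Definition avg_objective f (u : 'rV[R]_p) : R := n%:R^-1 * \sum_(i < n) f i u.

Definition unique_minimizer (h : 'rV[R]_p -> R) (u : 'rV[R]_p) : Prop :=
  (forall v, h u <= h v) /\ (forall u', (forall v, h u' <= h v) -> u' = u).

End objectives.

Section network.
Context {R : realType} {n : nat}.

Definition connected_graph (e : rel 'I_n) : Prop :=
  symmetric e /\ forall i j, connect e i j.

Definition mixing_matrix (e : rel 'I_n) (W : 'M[R]_n) : Prop :=
  [/\ forall i j, 0 <= W i j,
      forall i j, i != j -> e i j -> 0 < W i j /\ 0 < W j i,
      forall i j, i != j -> ~~ e i j -> W i j = 0 /\ W j i = 0,
      W *m const_mx 1 = const_mx 1 :> 'cV[R]_n
    & const_mx 1 *m W = const_mx 1 :> 'rV[R]_n].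

Definition rho (W : 'M[R]_n) : R := spectral_norm (W - const_mx n%:R^-1).

End network.

(* The iterates as a function of the realized noise z k i. *)
Fixpoint dsgd {R : realType} {n p m : nat} (W : 'M[R]_n) (alpha : nat -> R)
    (g : 'I_n -> 'rV[R]_p -> 'rV[R]_m -> 'rV[R]_p) (x0 : 'I_n -> 'rV[R]_p)
    (z : nat -> 'I_n -> 'rV[R]_m) (k : nat) (i : 'I_n) : 'rV[R]_p :=
  if k is k'.+1 then
    \sum_(j < n) W i j *: (dsgd W alpha g x0 z k' j
                           - alpha k' *: g j (dsgd W alpha g x0 z k' j) (z k' j))
  else x0 i.

Section conditioning.
Context {d : measure_display} {Omega : measurableType d} {R : realType}.
Variable P : probability Omega R.
Implicit Types (G : set (set Omega)) (Y Z : Omega -> R).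

Definition quasi_integrable Y : Prop :=
  measurable_fun setT Y /\
  (P.-integrable setT (EFin \o Y) \/ forall w, 0 <= Y w).

(* Z is a version of E[Y | G], for a sigma-algebra G of events and for Y either
   integrable or nonnegative. *)
Definition cond_expectation G Y Z : Prop :=
  [/\ quasi_integrable Y, quasi_integrable Z,
      forall B : set R, measurable B -> G (Z @^-1` B)
    & forall A, G A -> (\int[P]_(w in A) (Y w)%:E = \int[P]_(w in A) (Z w)%:E)%E].

(* The product rule over all of 'I_n suffices: taking some B i to be setT gives
   it for every subfamily. *)
Definition cond_independent {dT} {T : measurableType dT} {n : nat} G
    (X : 'I_n -> Omega -> T) : Prop :=
  forall B : 'I_n -> set T, (forall i, measurable (B i)) ->
  exists q : 'I_n -> Omega -> R,
    (forall i, cond_expectation G \1_(X i @^-1` B i) (q i)) /\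
    cond_expectation G \1_(\bigcap_i (X i @^-1` B i))
                     (fun w => \prod_(i < n) q i w).

(* sigma-algebra generated by x l i for all l <= k and all i *)
Definition history {n p : nat} (x : nat -> 'I_n -> Omega -> 'rV[R]_p) (k : nat) :
    set (set Omega) :=
  <<s \bigcup_(l in [set l | (l <= k)%N]) \bigcup_(i in [set: 'I_n])
        preimage_set_system setT (x l i) measurable >>.

(* The conditional mean is taken coordinatewise; V is a version of the
   conditional second moment of the error. *)
Definition gradient_noise (sigma M : R) {n p m : nat}
    (f : 'I_n -> 'rV[R]_p -> R) (g : 'I_n -> 'rV[R]_p -> 'rV[R]_m -> 'rV[R]_p)
    (x : nat -> 'I_n -> Omega -> 'rV[R]_p)
    (xi : nat -> 'I_n -> Omega -> 'rV[R]_m) : Prop :=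
  forall k,
  [/\ cond_independent (history x k) (xi k),
      forall i j, cond_expectation (history x k)
        (fun w => g i (x k i w) (xi k i w) 0 j)
        (fun w => gradient (f i) (x k i w) 0 j)
    & forall i, exists2 V : Omega -> R,
        cond_expectation (history x k)
          (fun w => enorm (g i (x k i w) (xi k i w)
                           - gradient (f i) (x k i w)) ^+ 2) V
      & {ae P, forall w,
          V w <= sigma ^+ 2 + M * enorm (gradient (f i) (x k i w)) ^+ 2}].

End conditioning.

Section constants.
Context {R : realType}.
Implicit Types theta mu L sigma M A B X rho_w : R.

(* Only used for nonnegative reals, where the absolute value changes nothing. *)
Definition nceil (r : R) : nat := `|Num.ceil r|%N.

Definition Kconst theta mu L M : nat :=
  nceil (2 * theta * (1 + M) * L ^+ 2 / mu ^+ 2).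

Definition K1const theta mu L M rho_w : nat :=
  nceil (Num.max (2 * (Kconst theta mu L M)%:R) (16 / (1 - rho_w ^+ 2))).

Definition stepsize theta mu L M (k : nat) : R :=
  theta / (mu * (k + Kconst theta mu L M)%:R).

Definition Aconst {n p : nat} (x0 : 'I_n -> 'rV[R]_p) (xs : 'rV[R]_p) : R :=
  \sum_(i < n) enorm (x0 i - xs) ^+ 2.

Definition Bconst {n p : nat} (f : 'I_n -> 'rV[R]_p -> R) (xs : 'rV[R]_p) : R :=
  \sum_(i < n) enorm (gradient (f i) xs) ^+ 2.

Definition Mbar sigma M (n : nat) B : R := 2 * M * B / n%:R + sigma ^+ 2.

Definition Xhat mu L sigma M (n : nat) A B : R :=
  Num.max A (9 * B / mu ^+ 2 + n%:R * sigma ^+ 2 / ((1 + M) * L ^+ 2)).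

Definition c2 mu L sigma M (n : nat) A B : R :=
  2 * M * L ^+ 2 / n%:R * Xhat mu L sigma M n A B + Mbar sigma M n B.

End constants.

(* Main.v *)
From mathcomp Require Import ring lra measurable_realfun.
Require Import Defs.

(** Three quantities are followed along the run, with [t = k + K] the shifted
    time: the total squared distance [X k = E sum_i |x_i - xs|^2], the
    disagreement [V k = E sum_i |x_i - xbar|^2] and the squared distance of the
    mean [U k = E |xbar - xs|^2].  Each of them satisfies a scalar recursion, and
    the three recursions are solved one after the other.

    Write a stochastic gradient as the gradient plus a noise vector.  Conditionally
    on the history the noise has mean zero, and the noises of two agents are
    uncorrelated.  Hence every squared norm that has to be estimated splits into
    the squared norm of a noiseless step, which is a deterministic inequality
    about gradients, and [alpha_k ^ 2] times a noise variance.

    - [total_distance_step]: mixing by a doubly stochastic matrix does not increase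
      the total distance, and a gradient step contracts it, so that
      [X (k+1) <= (1 - alpha_k mu / 2) X k + 3 alpha_k B / mu + alpha_k^2 n sigma^2].
      The choice of [K] makes [Xhat] an invariant bound ([distance_recursion]),
      and all gradients are then bounded in mean square ([total_gradient_le]).

    - [disagreement_step]: deviations from the mean are mixed by [W - J], whose
      norm is [rho]; with [delta = 1 - rho^2] this gives
      [V (k+1) <= (1 - delta / 2) V k + alpha_k^2 Q / delta], and
      [disagreement_recursion] concludes [V k <= Vh / t^2] with [Vh] of order
      [(A + B + n) / (1 - rho)^2].

    - [mean_step]: since mixing preserves the mean, [xbar] makes a gradient step
      for the average objective up to the disagreement, and averaging [n]
      uncorrelated noises divides their variance by [n]:
      [U (k+1) <= (1 - 3/2 alpha_k mu) U k + O(alpha_k / n) V k + alpha_k^2 c2 / n].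
      In [mean_recursion] the last term produces exactly the leading term of the
      bound, and the other two only contribute to the remainder [c / t^2].

    The measure-theoretic content is that [E(Y h) = 0] when [E(h | G) = 0] and [Y]
    is [G]-measurable ([centeredM]), and that the noises of distinct agents are
    uncorrelated ([cond_independent_uncorrelated]).  Both rest on one principle:
    an integrable [h] whose integral vanishes on all events of [Y] is orthogonal
    to [Y] ([orthogonal_to_preimages]).  For pairs of variables it is enough to
    test rectangles ([orthogonal_to_pair_events]), which is what allows
    conditional independence to be used without conditional distributions. *)

Set Implicit Arguments.
Unset Strict Implicit.
Unset Printing Implicit Defensive.

Local Open Scope classical_set_scope.
Local Open Scope ring_scope.

(** * Euclidean norm and mixing *)

Section euclidean_norm.
Context {R : realType} {q : nat}.
Implicit Types (u v w : 'rV[R]_q) (a : R).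

Lemma dotpC u v : dotp u v = dotp v u.
Proof. by apply: eq_bigr => i _; rewrite mulrC. Qed.

Lemma dotpDr w u v : dotp w (u + v) = dotp w u + dotp w v.
Proof. by rewrite -big_split; apply: eq_bigr => i _; rewrite mxE mulrDr. Qed.

Lemma dotpZr a u v : dotp u (a *: v) = a * dotp u v.
Proof. by rewrite mulr_sumr; apply: eq_bigr => i _; rewrite mxE mulrCA. Qed.

Lemma dotpNr u v : dotp u (- v) = - dotp u v.
Proof. by rewrite -scaleN1r dotpZr mulN1r. Qed.

Lemma dotpBr w u v : dotp w (u - v) = dotp w u - dotp w v.
Proof. by rewrite dotpDr dotpNr. Qed.

Lemma dotpBl w u v : dotp (u - v) w = dotp u w - dotp v w.
Proof. by rewrite dotpC dotpBr !(dotpC w). Qed.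

Lemma dotp_sumr (I : finType) (c : I -> 'rV[R]_q) u :
  dotp u (\sum_i c i) = \sum_i dotp u (c i).
Proof.
rewrite /dotp exchange_big /=; apply: eq_bigr => j _.
by rewrite summxE mulr_sumr.
Qed.

Lemma enorm_sqrE u : enorm u ^+ 2 = \sum_(i < q) u 0 i ^+ 2.
Proof.
rewrite sqr_sqrtr; first by apply: eq_bigr => i _; rewrite expr2.
by apply: sumr_ge0 => i _; rewrite -expr2 sqr_ge0.
Qed.

Lemma enorm_sqr u : enorm u ^+ 2 = dotp u u.
Proof. by rewrite enorm_sqrE; apply: eq_bigr => i _; rewrite expr2. Qed.

Lemma enorm_ge0 u : 0 <= enorm u.
Proof. exact: sqrtr_ge0. Qed.

Lemma enormB_sqr u v :
  enorm (u - v) ^+ 2 = enorm u ^+ 2 - 2 * dotp u v + enorm v ^+ 2.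
Proof. by rewrite !enorm_sqr dotpBl !dotpBr (dotpC v u); ring. Qed.

Lemma enormZ_sqr a u : enorm (a *: u) ^+ 2 = a ^+ 2 * enorm u ^+ 2.
Proof. by rewrite !enorm_sqr dotpZr dotpC dotpZr mulrA expr2. Qed.

Lemma enormZ a u : enorm (a *: u) = `|a| * enorm u.
Proof.
rewrite /enorm dotpZr dotpC dotpZr mulrA -expr2 sqrtrM ?sqr_ge0//.
by rewrite sqrtr_sqr.
Qed.

Lemma enormN u : enorm (- u) = enorm u.
Proof. by rewrite -scaleN1r enormZ normrN1 mul1r. Qed.

Lemma enorm0 : enorm (0 : 'rV[R]_q) = 0.
Proof. by rewrite -(scale0r (0 : 'rV[R]_q)) enormZ normr0 mul0r. Qed.

Lemma enorm_eq0 u : (enorm u == 0) = (u == 0).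
Proof.
apply/eqP/eqP => [u0|->]; last exact: enorm0.
have : \sum_(i < q) u 0 i ^+ 2 == 0 by rewrite -enorm_sqrE u0 expr0n.
rewrite psumr_eq0 => [/allP ui|i _]; last exact: sqr_ge0.
apply/rowP => i; rewrite mxE; apply/eqP; rewrite -sqrf_eq0.
by apply: ui; rewrite mem_index_enum.
Qed.

Lemma dotp_young a u v : 0 < a ->
  2 * dotp u v <= a * enorm u ^+ 2 + a^-1 * enorm v ^+ 2.
Proof.
move=> a0; have := sqr_ge0 (enorm (a *: u - v)).
rewrite enormB_sqr enormZ_sqr dotpC dotpZr (dotpC v).
move=> h; rewrite -(ler_pM2l a0) mulrDr [in X in _ <= _ + X]mulrA divff ?gt_eqF//.
by move: h; nra.
Qed.

Lemma dotp_young_opp a u v : 0 < a ->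
  - (2 * dotp u v) <= a * enorm u ^+ 2 + a^-1 * enorm v ^+ 2.
Proof. by move=> a0; rewrite -mulrN -dotpNr -(enormN v) dotp_young. Qed.

Lemma enormD_sqr_le a u v : 0 < a ->
  enorm (u + v) ^+ 2 <= (1 + a) * enorm u ^+ 2 + (1 + a^-1) * enorm v ^+ 2.
Proof.
move=> a0; rewrite -[in u + v](opprK v) enormB_sqr enormN dotpNr.
by have := dotp_young u v a0; lra.
Qed.

Lemma enormB_sqr_le a u v : 0 < a ->
  enorm (u - v) ^+ 2 <= (1 + a) * enorm u ^+ 2 + (1 + a^-1) * enorm v ^+ 2.
Proof. by move=> a0; rewrite -(enormN v) enormD_sqr_le. Qed.

End euclidean_norm.

(** Jensen's inequality for the square: the weighted variance is nonnegative. *)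
Lemma sqr_wsum_le {R : realFieldType} {I : finType} (w y : I -> R) :
  (forall i, 0 <= w i) -> \sum_i w i = 1 ->
  (\sum_i w i * y i) ^+ 2 <= \sum_i w i * y i ^+ 2.
Proof.
move=> w0 w1; set m := \sum_i w i * y i.
have : 0 <= \sum_i w i * (y i - m) ^+ 2.
  by apply: sumr_ge0 => i _; rewrite mulr_ge0 ?sqr_ge0.
rewrite (eq_bigr (fun i => w i * y i ^+ 2 + (w i * y i) * (- 2 * m) + w i * m ^+ 2)).
  by rewrite !big_split /= -!mulr_suml -/m w1; lra.
by move=> i _; ring.
Qed.

Section mixing.
Context {R : realType} {n p : nat}.
Implicit Types (A W : 'M[R]_n) (y : 'I_n -> 'rV[R]_p).

Lemma sum_enorm_sqrE y :
  \sum_i enorm (y i) ^+ 2 = \sum_(a < p) \sum_i y i 0 a ^+ 2.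
Proof.
by rewrite exchange_big; apply: eq_bigr => i _; rewrite enorm_sqrE.
Qed.

Lemma coord_mix A y i a :
  (\sum_j A i j *: y j) 0 a = \sum_j A i j * y j 0 a.
Proof. by rewrite summxE; apply: eq_bigr => j _; rewrite mxE. Qed.

Lemma enorm_average_le y : (0 < n)%N ->
  enorm (average y) ^+ 2 <= n%:R^-1 * \sum_i enorm (y i) ^+ 2.
Proof.
move=> n0; rewrite enorm_sqrE sum_enorm_sqrE mulr_sumr; apply: ler_sum => a _.
rewrite mxE summxE !mulr_sumr; apply: sqr_wsum_le.
  by move=> i; rewrite invr_ge0 ler0n.
by rewrite sumr_const card_ord -[_ *+ n]mulr_natl divff // pnatr_eq0 -lt0n.
Qed.

Lemma mixing_row_sum (e : rel 'I_n) W i : mixing_matrix e W -> \sum_j W i j = 1.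
Proof.
case=> _ _ _ + _ => /matrixP/(_ i 0); rewrite !mxE => <-.
by apply: eq_bigr => j _; rewrite mxE mulr1.
Qed.

Lemma mixing_col_sum (e : rel 'I_n) W j : mixing_matrix e W -> \sum_i W i j = 1.
Proof.
case=> _ _ _ _ /matrixP/(_ 0 j); rewrite !mxE => <-.
by apply: eq_bigr => i _; rewrite mxE mul1r.
Qed.

(** Jensen's inequality in every row, then the column sums. *)
Lemma mixing_contracts (e : rel 'I_n) W y : mixing_matrix e W ->
  \sum_i enorm (\sum_j W i j *: y j) ^+ 2 <= \sum_i enorm (y i) ^+ 2.
Proof.
move=> We; rewrite !sum_enorm_sqrE; apply: ler_sum => a _.
apply: (@le_trans _ _ (\sum_i \sum_j W i j * y j 0 a ^+ 2)).
  apply: ler_sum => i _; rewrite coord_mix; apply: sqr_wsum_le.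
    by move=> j; case: We.
  exact: mixing_row_sum We.
rewrite exchange_big le_eqVlt; apply/orP; left; apply/eqP.
by apply: eq_bigr => j _; rewrite -mulr_suml (mixing_col_sum j We) mul1r.
Qed.

Lemma average_mix (e : rel 'I_n) W y : mixing_matrix e W ->
  average (fun i => \sum_j W i j *: y j) = average y.
Proof.
move=> We; rewrite /average exchange_big; congr (_ *: _).
by apply: eq_bigr => j _; rewrite -scaler_suml (mixing_col_sum j We) scale1r.
Qed.

(** [W - J] annihilates constant families, so the deviations from the average
    are mixed by [W - J] alone. *)
Lemma mix_sub_average (e : rel 'I_n) W y (c : 'rV[R]_p) i :
  (0 < n)%N -> mixing_matrix e W ->
  \sum_j W i j *: y j - average (fun i => \sum_j W i j *: y j)
  = \sum_j (W - const_mx n%:R^-1) i j *: (y j - c).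
Proof.
move=> n0 We; rewrite (average_mix y We) /average scaler_sumr -sumrB.
transitivity (\sum_j (W - const_mx n%:R^-1) i j *: y j).
  by apply: eq_bigr => j _; rewrite !mxE scalerBl.
rewrite -[LHS]subr0 [RHS](eq_bigr (fun j =>
  (W - const_mx n%:R^-1) i j *: y j - (W - const_mx n%:R^-1) i j *: c)); last first.
  by move=> j _; rewrite scalerBr.
rewrite sumrB; congr (_ - _); rewrite -scaler_suml.
rewrite (eq_bigr (fun j => W i j - n%:R^-1)); last by move=> j _; rewrite !mxE.
rewrite sumrB (mixing_row_sum i We) sumr_const card_ord -[_ *+ n]mulr_natl.
by rewrite divff ?subrr ?scale0r // pnatr_eq0 -lt0n.
Qed.

End mixing.

Section average_deviation.
Context {R : realType} {n p : nat}.
Implicit Types (y : 'I_n -> 'rV[R]_p) (z : 'rV[R]_p).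

Lemma average_sub y z : (0 < n)%N -> average (fun i => y i - z) = average y - z.
Proof.
move=> n0; rewrite /average sumrB scalerBr; congr (_ - _).
rewrite sumr_const card_ord -[z *+ n]scaler_nat scalerA mulVf ?scale1r //.
by rewrite pnatr_eq0 -lt0n.
Qed.

(** The average minimizes the sum of squared distances. *)
Lemma sum_deviation_le y z : (0 < n)%N ->
  \sum_i enorm (y i - average y) ^+ 2 <= \sum_i enorm (y i - z) ^+ 2.
Proof.
move=> n0; pose a := average y - z.
have nR : 0 < n%:R :> R by rewrite ltr0n.
have aE : \sum_i (y i - z) = n%:R *: a.
  by rewrite /a -average_sub // /average scalerA mulfV ?gt_eqF // scale1r.
have -> : \sum_i enorm (y i - average y) ^+ 2
    = \sum_i (enorm (y i - z) ^+ 2 - 2 * dotp a (y i - z) + enorm a ^+ 2).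
  apply: eq_bigr => i _; rewrite (dotpC a) -enormB_sqr; congr (enorm _ ^+ 2).
  by rewrite /a opprB addrA subrK.
rewrite big_split sumrB /= -mulr_sumr -dotp_sumr aE dotpZr -enorm_sqr.
rewrite sumr_const card_ord -[_ ^+ 2 *+ n]mulr_natl.
have := mulr_ge0 (ltW nR) (sqr_ge0 (enorm a)); lra.
Qed.

End average_deviation.

Section spectral.
Context {R : realType} {n : nat}.
Implicit Types (A : 'M[R]_n) (v : 'rV[R]_n).

Let unit_images A : set R :=
  [set enorm (v *m A^T) | v in [set v : 'rV[R]_n | enorm v <= 1]].

(** The supremum in [spectral_norm] is that of a bounded set: the coordinates of
    a vector of the unit ball are at most 1 in absolute value, so the absolute
    row sums bound the coordinates of its image. *)
Lemma spectral_has_sup A : has_sup (unit_images A).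
Proof.
split; first by exists 0, 0; rewrite /= ?mul0mx enorm0.
exists (Num.sqrt (\sum_i (\sum_j `|A i j|) ^+ 2)) => _ [v v1 <-].
rewrite -(ger0_norm (enorm_ge0 _)) -sqrtr_sqr ler_sqrt; last first.
  by apply: sumr_ge0 => i _; exact: sqr_ge0.
rewrite enorm_sqrE; apply: ler_sum => i _.
rewrite -[leLHS]real_normK ?num_real // ler_sqr ?nnegrE //; last exact: sumr_ge0.
rewrite mxE; apply: le_trans (ler_norm_sum _ _ _) _; apply: ler_sum => j _.
rewrite mxE normrM -[leRHS]mul1r ler_wpM2r //.
rewrite -(@ler_sqr _ `|_|) ?nnegrE // expr1n real_normK ?num_real //.
apply: (@le_trans _ _ (enorm v ^+ 2)); last by rewrite expr_le1 // enorm_ge0.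
by rewrite enorm_sqrE (bigD1 j) //= lerDl; apply: sumr_ge0 => k _; exact: sqr_ge0.
Qed.

Lemma spectral_norm_ge0 A : 0 <= spectral_norm A.
Proof.
apply: ub_le_sup; first by case: (spectral_has_sup A).
by exists 0; rewrite /= ?mul0mx enorm0.
Qed.

Lemma spectral_normP A v : enorm (v *m A^T) <= spectral_norm A * enorm v.
Proof.
have [->|v0] := eqVneq v 0; first by rewrite mul0mx !enorm0 mulr0.
have v_gt0 : 0 < enorm v by rewrite lt_neqAle eq_sym enorm_eq0 v0 enorm_ge0.
rewrite -ler_pdivrMr //; apply: ub_le_sup; first by case: (spectral_has_sup A).
have nV : `|(enorm v)^-1| = (enorm v)^-1 by rewrite ger0_norm // invr_ge0 ltW.
exists ((enorm v)^-1 *: v); first by rewrite /= enormZ nV mulVf ?gt_eqF.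
by rewrite -scalemxAl enormZ nV mulrC.
Qed.

(** The operator norm acts on each of the [p] coordinates of a family of [n]
    vectors separately. *)
Lemma spectral_contracts {p : nat} A (y : 'I_n -> 'rV[R]_p) :
  \sum_i enorm (\sum_j A i j *: y j) ^+ 2
  <= spectral_norm A ^+ 2 * \sum_i enorm (y i) ^+ 2.
Proof.
rewrite !sum_enorm_sqrE mulr_sumr; apply: ler_sum => a _.
have : enorm ((\row_j y j 0 a) *m A^T) ^+ 2
    <= (spectral_norm A * enorm (\row_j y j 0 a)) ^+ 2.
  by rewrite ler_sqr ?spectral_normP // nnegrE ?mulr_ge0 ?spectral_norm_ge0 ?enorm_ge0.
rewrite exprMn !enorm_sqrE => h; apply: le_trans (le_trans h _).
  rewrite le_eqVlt; apply/orP; left; apply/eqP; apply: eq_bigr => i _.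
  by rewrite coord_mix mxE; congr (_ ^+ 2); apply: eq_bigr => j _; rewrite !mxE mulrC.
rewrite ler_wpM2l ?sqr_ge0 // le_eqVlt; apply/orP; left; apply/eqP.
by apply: eq_bigr => i _; rewrite mxE.
Qed.

End spectral.

(** * Strongly convex objectives with Lipschitz gradients *)

(** Along every coordinate line the function has a minimum at the origin. *)
Lemma gradient_at_min {R : realType} {p : nat} (h : 'rV[R]_p -> R) (u : 'rV[R]_p) :
  (forall v, differentiable h v) -> (forall v, h u <= h v) -> gradient h u = 0.
Proof.
move=> dh hmin; apply/rowP => j; rewrite !mxE.
pose v : 'rV[R]_p := delta_mx 0 j; pose line (t : R) := h (t *: v + u).
have dline t : derivable line t 1.
  by apply/derivable1_diffP; apply: differentiable_comp.
suff: is_derive (0 : R) (1 : R) line 0.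
  move=> is_d; rewrite -(@derive_val _ _ _ _ _ _ _ is_d) /derive.
  set a := (X in X @ _); set b := (X in _ = lim (X @ _)).
  suff -> : a = b by [].
  rewrite funeqE /a /b /line => t /=.
  by rewrite addr0 scale0r add0r [_%:A]mulr1.
apply: (@derive1_at_min _ line (-1) 1) => //.
  by rewrite in_itv /= ltrN10 ltr01.
by move=> t _; rewrite /line scale0r add0r.
Qed.

Section objectives.
Context {R : realType} {n p : nat} {mu L : R}.
Context (f : 'I_n -> 'rV[R]_p -> R).
Hypothesis f_scs : forall i, strongly_convex_smooth mu L (f i).

Let f_diff i u : differentiable (f i) u. Proof. by case: (f_scs i). Qed.

Lemma gradient_strongly_monotone i u v :
  mu * enorm (u - v) ^+ 2 <= dotp (gradient (f i) u - gradient (f i) v) (u - v).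
Proof. by case: (f_scs i). Qed.

Lemma gradient_lipschitz i u v : 0 <= L ->
  enorm (gradient (f i) u - gradient (f i) v) ^+ 2 <= L ^+ 2 * enorm (u - v) ^+ 2.
Proof.
by move=> L0; rewrite -exprMn ler_sqr ?nnegrE ?mulr_ge0 ?enorm_ge0 //; case: (f_scs i).
Qed.

Lemma average_gradient_at_min xs : unique_minimizer (avg_objective f) xs ->
  average (fun i => gradient (f i) xs) = 0.
Proof.
case=> xs_min _.
have dsum v : differentiable (\sum_(i < n) f i) v.
  by apply: differentiable_sum => i; exact: f_diff.
have avgE : avg_objective f = n%:R^-1 *: \sum_(i < n) f i.
  by apply/funext => v; rewrite /avg_objective !fctE fct_sumE.
have davg v : differentiable (avg_objective f) v.
  by rewrite avgE; exact: differentiableZ.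
have := gradient_at_min davg xs_min => /rowP g0.
apply/rowP => j; have := g0 j; rewrite !mxE avgE deriveZ; last exact: diff_derivable.
rewrite derive_sum; last by move=> i; apply: diff_derivable.
move=> <-; congr (_ * _); rewrite summxE; by apply: eq_bigr => i _; rewrite mxE.
Qed.

(** Strong monotonicity and Lipschitz continuity of the gradient are compared at
    the two distinct points [v] and [0], which exist because [0 < p]. *)
Lemma strong_convexity_le_smoothness : (0 < n)%N -> (0 < p)%N -> 0 < L -> mu <= L.
Proof.
move=> n0 p0 L0; pose i := Ordinal n0; pose v : 'rV[R]_p := const_mx 1.
have v_gt0 : 0 < enorm v ^+ 2.
  rewrite exprn_gt0 // lt_neqAle eq_sym enorm_eq0 enorm_ge0 andbT.
  by apply/eqP => /rowP/(_ (Ordinal p0)); rewrite !mxE => /eqP; rewrite oner_eq0.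
have := gradient_strongly_monotone i v 0; have := gradient_lipschitz i v 0 (ltW L0).
rewrite subr0 => h1 h2.
have := dotp_young v (gradient (f i) v - gradient (f i) 0) L0; rewrite dotpC => h3.
have h4 : L^-1 * enorm (gradient (f i) v - gradient (f i) 0) ^+ 2 <= L * enorm v ^+ 2.
  by rewrite ler_pdivrMl // mulrA -expr2.
by rewrite -(ler_pM2r v_gt0); lra.
Qed.

(** Of the contraction [2 alpha mu], Young's inequality for the gradient at [xs]
    costs [alpha mu / 2], and the terms of order [alpha ^ 2], which include the
    variance proportional to the squared gradient, cost [alpha mu]. *)
Lemma local_step_le (M alpha : R) i x xs :
  0 < mu -> mu <= L -> 0 < M -> 0 <= alpha -> 2 * alpha * (1 + M) * L ^+ 2 <= mu ->
  enorm (x - alpha *: gradient (f i) x - xs) ^+ 2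
    + alpha ^+ 2 * M * enorm (gradient (f i) x) ^+ 2
  <= (1 - alpha * mu / 2) * enorm (x - xs) ^+ 2
     + 3 * alpha / mu * enorm (gradient (f i) xs) ^+ 2.
Proof.
move=> mu0 muL M0 a0 aM; have L0 : 0 < L by exact: lt_le_trans muL.
set G := gradient (f i) x; set Gs := gradient (f i) xs.
rewrite [x - _ - _]addrAC (enormB_sqr (x - xs) (alpha *: G)) enormZ_sqr dotpZr.
have hm : mu * enorm (x - xs) ^+ 2 <= dotp (G - Gs) (x - xs).
  exact: gradient_strongly_monotone.
have hl : enorm (G - Gs) ^+ 2 <= L ^+ 2 * enorm (x - xs) ^+ 2.
  exact: gradient_lipschitz (ltW L0).
have hG : enorm G ^+ 2 <= 2 * enorm (G - Gs) ^+ 2 + 2 * enorm Gs ^+ 2.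
  by have := enormD_sqr_le (G - Gs) Gs ltr01; rewrite subrK invr1; lra.
have mu2 : 0 < mu / 2 by rewrite divr_gt0.
have hy := dotp_young_opp (x - xs) Gs mu2.
have -> : dotp (x - xs) G = dotp (G - Gs) (x - xs) + dotp (x - xs) Gs.
  by rewrite !(dotpC (x - xs)) dotpBl subrK.
set r := enorm (x - xs) ^+ 2 in hm hl hG hy *; set b := enorm Gs ^+ 2 in hm hl hG hy *.
have r0 : 0 <= r by exact: sqr_ge0.
have b0 : 0 <= b by exact: sqr_ge0.
have {}hG : enorm G ^+ 2 <= 2 * L ^+ 2 * r + 2 * b by lra.
have e1 : alpha * (alpha * (1 + M) * enorm G ^+ 2)
    <= alpha * (alpha * (1 + M) * (2 * L ^+ 2 * r + 2 * b)).
  by do 2 rewrite ler_wpM2l // ?mulr_ge0 //; lra.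
have e2 : alpha * (2 * alpha * (1 + M) * L ^+ 2 * r) <= alpha * (mu * r).
  by rewrite ler_wpM2l // ler_wpM2r.
have e3 : alpha * (2 * alpha * (1 + M) * b) <= alpha * (mu^-1 * b).
  rewrite ler_wpM2l // ler_wpM2r // -[leRHS]mul1r ler_pdivlMr //.
  rewrite -(ler_pM2r mu0) mul1r; apply: le_trans aM.
  rewrite -[leLHS]mulrA ler_wpM2l // ?mulr_ge0 //; first by lra.
  by rewrite expr2 ler_pM // ltW.
have e4 : alpha * (mu * r) <= alpha * dotp (G - Gs) (x - xs) by rewrite ler_wpM2l.
have e5 : alpha * - (2 * dotp (x - xs) Gs) <= alpha * (mu / 2 * r + (mu / 2)^-1 * b).
  by rewrite ler_wpM2l.
have e6 : (mu / 2)^-1 = 2 * mu^-1 by rewrite invfM invrK mulrC.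
by rewrite e6 in e5; move: e1 e2 e3 e4 e5; lra.
Qed.

(** With [G] the gradient of the average objective at the mean, the step
    [alpha *: G] has contraction factor [1 - 7/4 alpha mu], because
    [alpha ^+ 2 * L ^+ 2 <= alpha * mu / 4].  The averaged gradient at the iterates
    is Lipschitz-close to [G] in terms of the disagreement, and Young's inequality
    with weight [alpha mu / 4] leaves the factor [1 - 3/2 alpha mu]. *)
Lemma mean_step_le (alpha : R) (x : 'I_n -> 'rV[R]_p) xs :
  (0 < n)%N -> 0 < mu -> 0 < L -> 0 < alpha -> 4 * alpha * L ^+ 2 <= mu ->
  mu <= L -> average (fun i => gradient (f i) xs) = 0 ->
  enorm (average x - xs - alpha *: average (fun i => gradient (f i) (x i))) ^+ 2
  <= (1 - 3 / 2 * (alpha * mu)) * enorm (average x - xs) ^+ 2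
     + 5 * alpha * L ^+ 2 / (n%:R * mu) * \sum_i enorm (x i - average x) ^+ 2.
Proof.
move=> n0 mu0 L0 a0 aL muL grad0; have nR : 0 < n%:R :> R by rewrite ltr0n.
set xb := average x; set Gb := average (fun i => gradient (f i) xb).
set Gx := average (fun i => gradient (f i) (x i)).
have avgB (y z : 'I_n -> 'rV[R]_p) : average y - average z = average (fun i => y i - z i).
  by rewrite /average -scalerBr sumrB.
have GbE : Gb = average (fun i => gradient (f i) xb - gradient (f i) xs).
  by rewrite -avgB grad0 subr0.
have avg_le (y : 'I_n -> 'rV[R]_p) (s : 'I_n -> R) :
    (forall i, enorm (y i) ^+ 2 <= L ^+ 2 * s i) ->
    enorm (average y) ^+ 2 <= L ^+ 2 * (n%:R^-1 * \sum_i s i).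
  move=> ys; apply: le_trans (enorm_average_le y n0) _.
  rewrite mulrCA ler_wpM2l ?invr_ge0 ?ler0n // mulr_sumr.
  by apply: ler_sum => i _; exact: ys.
have h1 : enorm Gb ^+ 2 <= L ^+ 2 * enorm (xb - xs) ^+ 2.
  have := avg_le (fun i => gradient (f i) xb - gradient (f i) xs)
     (fun=> enorm (xb - xs) ^+ 2).
  rewrite -GbE sumr_const card_ord -[enorm _ ^+ 2 *+ n]mulr_natl mulKf ?gt_eqF //; apply.
  by move=> i; exact: gradient_lipschitz (ltW L0).
have h2 : enorm (Gb - Gx) ^+ 2 <= L ^+ 2 * (n%:R^-1 * \sum_i enorm (x i - xb) ^+ 2).
  rewrite avgB; apply: avg_le => i; rewrite -(enormN (x i - xb)) opprB.
  exact: gradient_lipschitz (ltW L0).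
have h3 : mu * enorm (xb - xs) ^+ 2 <= dotp Gb (xb - xs).
  rewrite GbE /average dotpC dotpZr dotp_sumr ler_pdivlMl // mulr_natl.
  rewrite -[X in _ *+ X]card_ord -sumr_const. apply: ler_sum => i _.
  by rewrite dotpC; exact: gradient_strongly_monotone.
have -> : xb - xs - alpha *: Gx = (xb - xs - alpha *: Gb) + alpha *: (Gb - Gx).
  by rewrite scalerBr addrA subrK.
have am : 0 < alpha * mu / 4 by rewrite divr_gt0 // mulr_gt0.
apply: le_trans (enormD_sqr_le _ _ am) _.
rewrite (enormB_sqr (xb - xs) (alpha *: Gb)) !(enormZ_sqr alpha) dotpZr (dotpC _ Gb).
set r := enorm (xb - xs) ^+ 2 in h1 h3 *; set V := \sum_i _ in h2 *.
have r0 : 0 <= r by exact: sqr_ge0.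
have V0 : 0 <= V by apply: sumr_ge0 => i _; exact: sqr_ge0.
have amu : alpha * mu <= 4^-1.
  rewrite -(ler_pM2r (mulr_gt0 L0 L0)); apply: (@le_trans _ _ (alpha * (L * L) * mu)).
    by rewrite mulrAC.
  apply: (@le_trans _ _ (mu / 4 * mu)).
    by rewrite ler_wpM2r ?(ltW mu0) //; move: aL; rewrite expr2; lra.
  have : mu * mu <= L * L by rewrite ler_pM // ltW.
  by lra.
have f1 : r - 2 * (alpha * dotp Gb (xb - xs)) + alpha ^+ 2 * enorm Gb ^+ 2
    <= (1 - 7 / 4 * (alpha * mu)) * r.
  have : alpha * (mu * r) <= alpha * dotp Gb (xb - xs) by rewrite ler_wpM2l // (ltW a0).
  have : alpha ^+ 2 * enorm Gb ^+ 2 <= alpha * (mu / 4 * r).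
    rewrite expr2 -mulrA ler_wpM2l ?(ltW a0) //.
    apply: (@le_trans _ _ (alpha * (L ^+ 2 * r))); first by rewrite ler_wpM2l ?(ltW a0).
    by rewrite mulrA ler_wpM2r //; lra.
  by lra.
apply: lerD.
  apply: (@le_trans _ _ ((1 + alpha * mu / 4) * ((1 - 7 / 4 * (alpha * mu)) * r))).
    by rewrite ler_wpM2l //; lra.
  rewrite mulrA ler_wpM2r //; have := sqr_ge0 (alpha * mu); nra.
apply: (@le_trans _ _ ((1 + (alpha * mu / 4)^-1)
    * (alpha ^+ 2 * (L ^+ 2 * (n%:R^-1 * V))))).
  by rewrite !ler_wpM2l ?sqr_ge0 // addr_ge0 // invr_ge0 ltW.
rewrite [leLHS](_ : _ = (alpha * mu + 4) * (alpha * L ^+ 2 / (n%:R * mu) * V)); last first.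
  by field; rewrite !gt_eqF.
rewrite [leRHS](_ : _ = 5 * (alpha * L ^+ 2 / (n%:R * mu) * V)); last first.
  by field; rewrite !gt_eqF.
rewrite ler_wpM2r //; last by lra.
by rewrite mulr_ge0 // divr_ge0 // ?mulr_ge0 ?sqr_ge0 // ltW.
Qed.

End objectives.

(** The weight [(1 - r2) / 2] in Young's inequality makes the factor in front
    of the disagreement, multiplied by [r2], at most [(1 + r2) / 2]. *)
Lemma disagreement_step_le {R : realType} {p : nat} (r2 M alpha : R)
    (y G : 'rV[R]_p) :
  r2 < 1 -> 0 <= r2 ->
  enorm (y - alpha *: G) ^+ 2 + alpha ^+ 2 * M * enorm G ^+ 2
  <= (1 + (1 - r2) / 2) * enorm y ^+ 2
     + alpha ^+ 2 * (3 / (1 - r2) + M) * enorm G ^+ 2.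
Proof.
move=> r1 r0; have d0 : 0 < 1 - r2 by rewrite subr_gt0.
have d2 : 0 < (1 - r2) / 2 by rewrite divr_gt0.
have := enormB_sqr_le y (alpha *: G) d2; rewrite enormZ_sqr => h.
have : (1 + ((1 - r2) / 2)^-1) * (alpha ^+ 2 * enorm G ^+ 2)
    <= 3 / (1 - r2) * (alpha ^+ 2 * enorm G ^+ 2).
  rewrite ler_wpM2r ?(mulr_ge0 (sqr_ge0 _) (sqr_ge0 _)) // invfM invrK.
  have : 1 <= (1 - r2)^-1 by rewrite invf_ge1 // gerBl.
  by lra.
by lra.
Qed.

(** * Stepsizes and scalar recursions *)

Section rounding.
Context {R : realType}.
Implicit Type r : R.

Lemma nceilE r : 0 <= r -> (nceil r)%:R = (Num.ceil r)%:~R :> R.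
Proof.
move=> r0; have c0 : (0 <= Num.ceil r)%R.
  by rewrite -(ler_int R); exact: le_trans r0 (ceil_ge _).
by rewrite /nceil natr_absz ger0_norm.
Qed.

Lemma nceil_ge r : 0 <= r -> r <= (nceil r)%:R.
Proof. by move=> r0; rewrite nceilE // ceil_ge. Qed.

Lemma nceil_le r : 0 <= r -> (nceil r)%:R <= r + 1.
Proof.
move=> r0; rewrite nceilE // ltW // -ltrBlDr -[1 in X in X < _]/(1%:~R) -intrB.
by rewrite gt_pred_ceil // num_real.
Qed.

End rounding.

Section steps.
Context {R : realType} (theta mu L M : R).
Hypotheses (theta_gt2 : 2 < theta) (mu_gt0 : 0 < mu) (L_gt0 : 0 < L).
Hypotheses (M_gt0 : 0 < M).

Let K := Kconst theta mu L M.
Let alpha := stepsize theta mu L M.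

Let theta_gt0 : 0 < theta. Proof. exact: lt_trans theta_gt2. Qed.

Let Kreal_gt0 : 0 < 2 * theta * (1 + M) * L ^+ 2 / mu ^+ 2.
Proof. by rewrite divr_gt0 ?exprn_gt0 // !mulr_gt0 ?exprn_gt0 ?addr_gt0. Qed.

Lemma Kconst_gt0 : (0 < K)%N.
Proof.
rewrite -(ltr_nat R); exact: lt_le_trans Kreal_gt0 (nceil_ge (ltW Kreal_gt0)).
Qed.

Let shift_gt0 k : 0 < (k + K)%:R :> R.
Proof. by rewrite ltr0n addn_gt0 Kconst_gt0 orbT. Qed.

Lemma stepsize_gt0 k : 0 < alpha k.
Proof. by rewrite divr_gt0 // mulr_gt0. Qed.

(** Whatever multiple of [K] the shifted time exceeds, the stepsize is smaller
    by that factor than the bound for which [K] was chosen. *)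
Lemma stepsize_le_scaled (s k : nat) : (s * K <= k + K)%N ->
  s%:R * (2 * alpha k * (1 + M) * L ^+ 2) <= mu.
Proof.
move=> sk; rewrite /alpha /stepsize -/K.
have sKt : (s * K)%:R <= (k + K)%:R :> R by rewrite ler_nat.
move: (shift_gt0 k) sKt; move: (k + K)%:R => t t0 sKt.
have -> : s%:R * (2 * (theta / (mu * t)) * (1 + M) * L ^+ 2)
    = s%:R * (2 * theta * (1 + M) * L ^+ 2 / mu ^+ 2) * mu / t.
  by field; rewrite !gt_eqF.
rewrite ler_pdivrMr // mulrC ler_wpM2l ?(ltW mu_gt0) //.
apply: le_trans sKt.
by rewrite natrM ler_wpM2l ?ler0n // nceil_ge // ltW.
Qed.

Lemma stepsize_le k : 2 * alpha k * (1 + M) * L ^+ 2 <= mu.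
Proof. by rewrite -[leLHS]mul1r (@stepsize_le_scaled 1) // mul1n leq_addl. Qed.

Section late_times.
Variable rho_w : R.
Hypotheses (rho_ge0 : 0 <= rho_w) (rho_lt1 : rho_w < 1).
Let K1 := K1const theta mu L M rho_w.

Let gap_gt0 : 0 < 1 - rho_w ^+ 2.
Proof. by rewrite subr_gt0 expr_lt1. Qed.

Let gap_ge : 1 - rho_w <= 1 - rho_w ^+ 2.
Proof. by rewrite lerD2l lerN2 expr2 ler_piMr // ltW. Qed.

Let K1real_ge0 : 0 <= Num.max (2 * K%:R) (16 / (1 - rho_w ^+ 2)).
Proof. by rewrite le_max mulr_ge0. Qed.

Lemma K1const_ge2K : (2 * K <= K1)%N.
Proof.
rewrite -(ler_nat R) natrM; apply: le_trans (nceil_ge K1real_ge0).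
by rewrite le_max lexx.
Qed.

Lemma K1const_ge_gap : 16 / (1 - rho_w ^+ 2) <= K1%:R.
Proof. by apply: le_trans (nceil_ge K1real_ge0); rewrite le_max lexx orbT. Qed.

(** Since [1 - rho_w] is at most 1 and at most [1 - rho_w ^+ 2], each argument of
    the maximum is at most its numerator divided by [1 - rho_w]; the number 17 is
    16 plus 1 for the rounding. *)
Lemma K1const_le : K1%:R <= (2 * K%:R + 17) / (1 - rho_w).
Proof.
have s0 : 0 < 1 - rho_w by rewrite subr_gt0.
apply: le_trans (nceil_le K1real_ge0) _.
have s1 : 1 <= (1 - rho_w)^-1 by rewrite invf_ge1 // gerBl.
have k0 : 0 <= K%:R :> R by [].
have ks : 2 * K%:R <= 2 * K%:R / (1 - rho_w) by rewrite ler_peMr // mulr_ge0.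
rewrite maxEle; case: ifP => _; last by rewrite mulrDl; lra.
have : 16 / (1 - rho_w ^+ 2) <= 16 / (1 - rho_w) by rewrite ler_pM2l // lef_pV2 ?posrE.
have : 0 <= 2 * K%:R / (1 - rho_w) by apply: le_trans ks; rewrite mulr_ge0.
by rewrite mulrDl; lra.
Qed.

Lemma late_shift k : (K1 - K <= k)%N -> (K1 <= k + K)%N.
Proof. by rewrite leq_subLR addnC. Qed.

Lemma late_start : (K1 - K + K = K1)%N.
Proof. by rewrite subnK // (leq_trans _ K1const_ge2K) // leq_pmull. Qed.

Lemma stepsize_le_late k : (K1 - K <= k)%N -> 4 * alpha k * L ^+ 2 <= mu.
Proof.
move=> /late_shift kK; have := @stepsize_le_scaled 2 k (leq_trans K1const_ge2K kK).
have := mulr_ge0 (mulr_ge0 (ltW (stepsize_gt0 k)) (sqr_ge0 L)) (ltW M_gt0).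
by lra.
Qed.

(** The disagreement decays like [1 / t ^ 2]: past [16 / d] the relative
    decrease of [1 / t ^ 2] in one step is smaller than the contraction [d / 2]
    minus the share [d / 3] left for the noise. *)
Lemma disagreement_recursion (V : nat -> R) (Q Vh : R) :
  0 <= Q -> V (K1 - K)%N <= Vh / K1%:R ^+ 2 ->
  3 * theta ^+ 2 * Q / (mu ^+ 2 * (1 - rho_w ^+ 2) ^+ 2) <= Vh ->
  (forall k, V k.+1 <= (1 - (1 - rho_w ^+ 2) / 2) * V k
                        + alpha k ^+ 2 * (Q / (1 - rho_w ^+ 2))) ->
  forall k, (K1 - K <= k)%N -> V k <= Vh / (k + K)%:R ^+ 2.
Proof.
move=> Q0 V0 VhQ Vrec; have g0 := gap_gt0.
set dl := 1 - rho_w ^+ 2 in g0 VhQ Vrec.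
have Vh0 : 0 <= Vh.
  apply: le_trans VhQ; rewrite divr_ge0 ?mulr_ge0 // ?ltW //.
elim=> [|k IHk].
  by rewrite leqn0 => /eqP k0; move: V0; rewrite -[X in X%:R ^+ 2]late_start k0.
rewrite leq_eqVlt => /predU1P[k1|]; first by rewrite -k1 late_start.
rewrite ltnS => kK; have {}IHk := IHk kK; apply: le_trans (Vrec k) _.
rewrite addSn /alpha /stepsize -/K -(natr1 (k + K)).
have tK : 16 / dl <= (k + K)%:R.
  by apply: le_trans K1const_ge_gap _; rewrite ler_nat late_shift.
move: (shift_gt0 k) tK IHk; move: (k + K)%:R => t t0 tK IHk.
have d1 : dl <= 1 by rewrite lerBlDr lerDl sqr_ge0.
have noise : (theta / (mu * t)) ^+ 2 * (Q / dl) <= dl / 3 * (Vh / t ^+ 2).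
  rewrite [leLHS](_ : _ = dl / 3 * (3 * theta ^+ 2 * Q / (mu ^+ 2 * dl ^+ 2) / t ^+ 2)).
    rewrite ler_wpM2l ?divr_ge0 ?(ltW g0) //.
    by rewrite ler_wpM2r // invr_ge0 sqr_ge0.
  by field; rewrite !gt_eqF.
have contr : (1 - dl / 2) * V k <= (1 - dl / 2) * (Vh / t ^+ 2).
  by rewrite ler_wpM2l //; lra.
apply: (@le_trans _ _ ((1 - dl / 6) * (Vh / t ^+ 2))).
  move: noise contr; move: (_ / t ^+ 2) (_ ^+ 2 * (Q / dl)) (V k) => vt nz v; lra.
rewrite mulrCA ler_wpM2l // ler_pdivrMr ?exprn_gt0 // [leRHS]mulrC.
rewrite ler_pdivlMr ?exprn_gt0 ?addr_gt0 //.
have : 16 <= t * dl by rewrite -ler_pdivrMr.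
move: g0 d1 t0; nra.
Qed.

(** The leading term [a0 / t] absorbs the noise exactly, since
    [1 / t - 1 / t ^ 2 <= 1 / (t + 1)]; the remainder [c / t ^ 2] survives
    because the contraction factor is at most [1 - 3 / t] while
    [1 / t ^ 2 - 2 / t ^ 3 <= 1 / (t + 1) ^ 2]. *)
Lemma mean_recursion (n : nat) (U V : nat -> R) (Vh c c2' : R) :
  (0 < n)%N -> 0 <= c2' -> 0 <= Vh -> mu <= L ->
  5 * theta * L ^+ 2 * Vh / (n%:R * mu ^+ 2) <= c ->
  U (K1 - K)%N <= c / K1%:R ^+ 2 ->
  (forall k, (K1 - K <= k)%N -> V k <= Vh / (k + K)%:R ^+ 2) ->
  (forall k, (K1 - K <= k)%N ->
     U k.+1 <= (1 - 3 / 2 * (alpha k * mu)) * U k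
       + 5 * alpha k * L ^+ 2 / (n%:R * mu) * V k + alpha k ^+ 2 * (c2' / n%:R)) ->
  forall k, (K1 - K <= k)%N ->
    U k <= theta ^+ 2 * c2' / ((3 / 2 * theta - 1) * n%:R * mu ^+ 2 * (k + K)%:R)
           + c / (k + K)%:R ^+ 2.
Proof.
move=> n0 c20 Vh0 muL cVh U0 VVh Urec; have nR : 0 < n%:R :> R by rewrite ltr0n.
have th1 : 0 < 3 / 2 * theta - 1 by have := theta_gt2; lra.
pose a0 := theta ^+ 2 * c2' / ((3 / 2 * theta - 1) * n%:R * mu ^+ 2).
have a00 : 0 <= a0 by rewrite divr_ge0 ?mulr_ge0 ?sqr_ge0 // ltW.
set b := 5 * theta * L ^+ 2 * Vh / (n%:R * mu ^+ 2) in cVh.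
have b0 : 0 <= b by rewrite divr_ge0 ?mulr_ge0 ?sqr_ge0 // ltW.
suff H k : (K1 - K <= k)%N -> U k <= a0 / (k + K)%:R + c / (k + K)%:R ^+ 2.
  by move=> k /H; rewrite /a0 -[_ / _ / _]mulrA -invfM.
have start : U (K1 - K)%N <= a0 / K1%:R + c / K1%:R ^+ 2.
  by apply: le_trans U0 _; rewrite lerDr divr_ge0.
elim: k => [|k IHk].
  rewrite leqn0 => /eqP k0; move: start.
  by rewrite -[X in X%:R ^+ 2]late_start -[X in _ / X%:R + _]late_start k0.
rewrite leq_eqVlt => /predU1P[k1|]; first by rewrite -k1 late_start.
rewrite ltnS => kK; have {}IHk := IHk kK; apply: le_trans (Urec k kK) _.
have a1 : 3 / 2 * (alpha k * mu) <= 1.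
  have h := stepsize_le_late kK; have ak := stepsize_gt0 k.
  have : alpha k * mu <= 4^-1.
    have m2 : mu ^+ 2 <= L ^+ 2 by rewrite ler_sqr ?nnegrE // ltW.
    have : 4 * alpha k * mu ^+ 2 <= mu.
      by apply: le_trans h; rewrite ler_wpM2l // (mulr_ge0 _ (ltW ak)).
    move=> ?; rewrite -(ler_pM2r mu_gt0); lra.
  by lra.
have {VVh}Vk := VVh k kK; move: IHk Vk; rewrite addSn -(natr1 (k + K)).
have := stepsize_gt0 k; move: a1; rewrite /alpha /stepsize -/K.
move: (shift_gt0 k); move: (k + K)%:R => t t0 a1 ak Uk Vk.
have am : theta / (mu * t) * mu = theta / t by field; rewrite !gt_eqF.
rewrite am in a1 *.
have t1 : 0 < t + 1 by rewrite addr_gt0.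
apply: (@le_trans _ _ ((1 - 3 / 2 * (theta / t)) * (a0 / t + c / t ^+ 2)
    + 5 * (theta / (mu * t)) * L ^+ 2 / (n%:R * mu) * (Vh / t ^+ 2)
    + (theta / (mu * t)) ^+ 2 * (c2' / n%:R))).
  rewrite lerD2r lerD // ler_wpM2l //; first by lra.
  by rewrite divr_ge0 ?mulr_ge0 ?invr_ge0 ?mulr_ge0 // ltW.
have -> : 5 * (theta / (mu * t)) * L ^+ 2 / (n%:R * mu) * (Vh / t ^+ 2) = b / t ^+ 3.
  by rewrite /b; field; rewrite !gt_eqF.
have -> : (theta / (mu * t)) ^+ 2 * (c2' / n%:R) = a0 * (3 / 2 * theta - 1) / t ^+ 2.
  rewrite /a0; field; rewrite !gt_eqF //=; move: th1; lra.
have c0 : 0 <= c by exact: le_trans cVh.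
have -> : (1 - 3 / 2 * (theta / t)) * (a0 / t + c / t ^+ 2) + b / t ^+ 3
    + a0 * (3 / 2 * theta - 1) / t ^+ 2
    = a0 * ((t - 1) / t ^+ 2) + (c * t - (3 / 2 * theta * c - b)) / t ^+ 3.
  by field; rewrite gt_eqF.
apply: lerD.
  rewrite ler_wpM2l // ler_pdivrMr ?exprn_gt0 // [leRHS]mulrC ler_pdivlMr //; nra.
apply: (@le_trans _ _ (c * ((t - 2) / t ^+ 3))).
  rewrite mulrA ler_wpM2r ?invr_ge0 ?exprn_ge0 ?(ltW t0) //.
  have : 2 * c <= theta * c by rewrite ler_wpM2r // ltW.
  by lra.
rewrite ler_wpM2l // ler_pdivrMr ?exprn_gt0 // [leRHS]mulrC ler_pdivlMr ?exprn_gt0 //.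
nra.
Qed.

End late_times.

(** [Xhat] is chosen so that [mu / 2 * Xhat] dominates the drift [3 B / mu] and, as
    [alpha] is at most [mu / (2 (1 + M) L ^ 2)], also the noise. *)
Lemma distance_recursion (n : nat) (X : nat -> R) (A B sigma : R) :
  0 <= A -> 0 <= B -> mu <= L -> X 0%N <= A ->
  (forall k, X k.+1 <= (1 - alpha k * mu / 2) * X k + 3 * alpha k / mu * B
                        + alpha k ^+ 2 * (n%:R * sigma ^+ 2)) ->
  forall k, X k <= Xhat mu L sigma M n A B.
Proof.
move=> A0 B0 muL X0 Xrec; set Xh := Xhat _ _ _ _ _ _ _.
have L2 : 0 < (1 + M) * L ^+ 2 by rewrite mulr_gt0 ?exprn_gt0 ?addr_gt0.
have S0 : 0 <= n%:R * sigma ^+ 2 by rewrite mulr_ge0 ?sqr_ge0.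
have Xh_ge : 9 * B / mu ^+ 2 + n%:R * sigma ^+ 2 / ((1 + M) * L ^+ 2) <= Xh.
  by rewrite /Xh /Xhat le_max lexx orbT.
elim=> [|k IHk]; first by apply: le_trans X0 _; rewrite /Xh /Xhat le_max lexx.
apply: le_trans (Xrec k) _.
have ak := stepsize_gt0 k; have h := stepsize_le k.
have amu : alpha k * mu <= 1.
  have m2 : mu ^+ 2 <= L ^+ 2 by rewrite ler_sqr ?nnegrE // ltW.
  have : alpha k * mu ^+ 2 <= mu.
    have : alpha k * mu ^+ 2 <= alpha k * L ^+ 2 by rewrite ler_wpM2l // ltW.
    have := mulr_ge0 (mulr_ge0 (ltW ak) (sqr_ge0 L)) (ltW M_gt0).
    have := mulr_ge0 (ltW ak) (sqr_ge0 L).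
    by lra.
  by move=> ?; rewrite -(ler_pM2r mu_gt0); lra.
have noise : alpha k ^+ 2 * (n%:R * sigma ^+ 2)
    <= alpha k * mu / 2 * (n%:R * sigma ^+ 2 / ((1 + M) * L ^+ 2)).
  rewrite [leRHS](_ : _ = alpha k * (mu / (2 * ((1 + M) * L ^+ 2))) * (n%:R * sigma ^+ 2)).
    rewrite ler_wpM2r // expr2 ler_wpM2l ?(ltW ak) // ler_pdivlMr ?(mulr_gt0 _ L2) //.
    by move: h; lra.
  by field; rewrite ?gt_eqF // addr_gt0.
have contr : (1 - alpha k * mu / 2) * X k <= (1 - alpha k * mu / 2) * Xh.
  by rewrite ler_wpM2l //; lra.
have drift : 3 * alpha k / mu * B <= alpha k * mu / 2 * (9 * B / mu ^+ 2).
  rewrite [leLHS](_ : _ = 3 * (alpha k * B / mu)); last by ring.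
  rewrite [leRHS](_ : _ = 9 / 2 * (alpha k * B / mu)); last by field; rewrite gt_eqF.
  by rewrite (ler_wpM2r (divr_ge0 (mulr_ge0 (ltW ak) B0) (ltW mu_gt0))) //; lra.
have : alpha k * mu / 2 * (9 * B / mu ^+ 2 + n%:R * sigma ^+ 2 / ((1 + M) * L ^+ 2))
    <= alpha k * mu / 2 * Xh.
  by rewrite ler_wpM2l // divr_ge0 // (mulr_ge0 (ltW ak) (ltW mu_gt0)).
by lra.
Qed.

End steps.

(** * Integrable and square-integrable functions *)

Import HBNNSimple.

Section expectation.
Context {d : measure_display} {Omega : measurableType d} {R : realType}.
Variable P : probability Omega R.
Implicit Types (f g h Y Z : Omega -> R) (a : R).

(** The total operator [Ex] is the expectation on [L1] only.  [L1] and [L2] are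
    predicates on plain functions, so that the iterates need not be packed. *)
Definition L1 f := P.-integrable setT (EFin \o f).

Definition Ex f : R := \int[P]_w f w.

Definition L2 f := measurable_fun setT f /\ L1 (fun w => f w ^+ 2).

Lemma L1_measurable f : L1 f -> measurable_fun setT f.
Proof. by move=> /measurable_int/measurable_EFinP. Qed.

Lemma eq_L1 f g : f =1 g -> L1 f -> L1 g.
Proof. by move=> /funext ->. Qed.

Lemma eq_Ex f g : f =1 g -> Ex f = Ex g.
Proof. by move=> /funext ->. Qed.

Lemma L1_le f g : measurable_fun setT f -> L1 g ->
  (forall w, `|f w| <= g w) -> L1 f.
Proof.
move=> mf ig fg; apply: le_integrable ig => //; first exact/measurable_EFinP.
by move=> w _ /=; rewrite lee_fin (le_trans (fg w)) // ler_norm.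
Qed.

Lemma L1_cst a : L1 (fun=> a).
Proof. exact: finite_measure_integrable_cst. Qed.

Lemma L1D f g : L1 f -> L1 g -> L1 (fun w => f w + g w).
Proof. by move=> fi gi; exact: (integrableD measurableT fi gi). Qed.

Lemma L1Z a f : L1 f -> L1 (fun w => a * f w).
Proof. by move=> fi; exact: (integrableZl measurableT a fi). Qed.

Lemma L1B f g : L1 f -> L1 g -> L1 (fun w => f w - g w).
Proof. by move=> fi gi; exact: (integrableB measurableT fi gi). Qed.

Lemma L1_sum (I : finType) (F : I -> Omega -> R) :
  (forall i, L1 (F i)) -> L1 (fun w => \sum_i F i w).
Proof.
move=> iF; rewrite /L1 (_ : _ \o _ = fun w => (\sum_i (F i w)%:E)%E).
  by apply: integrable_sum => // i _; exact: iF.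
by apply/funext => w /=; rewrite sumEFin.
Qed.

Lemma L1M_bounded f g a : L1 f -> measurable_fun setT g ->
  (forall w, `|g w| <= a) -> L1 (fun w => f w * g w).
Proof.
move=> fi mg ga; apply: (@L1_le _ (fun w => a * `|f w|)).
- by apply: measurable_funM => //; exact: L1_measurable.
- by apply: L1Z; exact: integrable_norm.
- by move=> w; rewrite normrM mulrC ler_wpM2r.
Qed.

Lemma norm_indic_le1 (A : set Omega) w : `|\1_A w : R| <= 1.
Proof. by rewrite indicE; case: (_ \in _); rewrite ?normr1 ?normr0. Qed.

Lemma L1M_indic f (A : set Omega) : measurable A -> L1 f ->
  L1 (fun w => f w * \1_A w).
Proof.
by move=> mA fi; apply: L1M_bounded fi _ (@norm_indic_le1 A); exact: measurable_indic.
Qed.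

Lemma Ex_cst a : Ex (fun=> a) = a.
Proof. by rewrite /Ex Rintegral_cst //= probability_setT mulr1. Qed.

Lemma ExD f g : L1 f -> L1 g -> Ex (fun w => f w + g w) = Ex f + Ex g.
Proof. by move=> fi gi; exact: RintegralD. Qed.

Lemma ExB f g : L1 f -> L1 g -> Ex (fun w => f w - g w) = Ex f - Ex g.
Proof. by move=> fi gi; exact: RintegralB. Qed.

Lemma ExZ a f : L1 f -> Ex (fun w => a * f w) = a * Ex f.
Proof. by move=> fi; exact: RintegralZl. Qed.

Lemma Ex_sum (I : finType) (F : I -> Omega -> R) :
  (forall i, L1 (F i)) -> Ex (fun w => \sum_i F i w) = \sum_i Ex (F i).
Proof.
move=> iF; rewrite /Ex /Rintegral.
rewrite (eq_integral (fun w => \sum_i (F i w)%:E)%E); last first.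
  by move=> w _; rewrite sumEFin.
rewrite integral_sum // -[RHS]/(fine (\sum_i Ex (F i))%:E) -sumEFin.
congr fine; apply: eq_bigr => i _; rewrite /Ex /Rintegral fineK //.
by apply: integrable_fin_num => //; exact: iF.
Qed.

Lemma le_Ex f g : L1 f -> L1 g -> (forall w, f w <= g w) -> Ex f <= Ex g.
Proof. by move=> fi gi fg; apply: le_Rintegral. Qed.

Lemma Ex_ge0 f : (forall w, 0 <= f w) -> 0 <= Ex f.
Proof. by move=> f0; apply: Rintegral_ge0. Qed.

Lemma integral_Ex f : L1 f -> (\int[P]_w (f w)%:E)%E = (Ex f)%:E.
Proof. by move=> fi; rewrite /Ex /Rintegral fineK //; exact: integrable_fin_num. Qed.

Lemma L2_mul f g : L2 f -> L2 g -> L1 (fun w => f w * g w).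
Proof.
move=> [mf fi] [mg gi]; apply: (@L1_le _ (fun w => f w ^+ 2 + g w ^+ 2)).
- exact: measurable_funM.
- exact: L1D.
- move=> w; rewrite normrM -[f w ^+ 2]real_normK ?num_real //.
  rewrite -[g w ^+ 2]real_normK ?num_real //.
  have := sqr_ge0 (`|f w| - `|g w|); have := normr_ge0 (f w); have := normr_ge0 (g w).
  nra.
Qed.

Lemma L2_cst a : L2 (fun=> a).
Proof. by split; [exact: measurable_cst | exact: L1_cst]. Qed.

Lemma L2_L1 f : L2 f -> L1 f.
Proof.
by move=> f2; apply: (eq_L1 _ (L2_mul f2 (L2_cst 1))) => w; rewrite mulr1.
Qed.

Lemma L2Z a f : L2 f -> L2 (fun w => a * f w).
Proof.
move=> [mf fi]; split; first exact: measurable_funM.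
by apply: (eq_L1 _ (L1Z (a ^+ 2) fi)) => w; rewrite exprMn.
Qed.

Lemma L2D f g : L2 f -> L2 g -> L2 (fun w => f w + g w).
Proof.
move=> f2 g2; have [[mf fi] [mg gi]] := (f2, g2).
split; first exact: measurable_funD.
by apply: (eq_L1 _ (L1D (L1D fi (L1Z 2 (L2_mul f2 g2))) gi)) => w; ring.
Qed.

Lemma L2B f g : L2 f -> L2 g -> L2 (fun w => f w - g w).
Proof.
move=> f2 g2; have := L2D f2 (L2Z (-1) g2).
by under eq_fun do rewrite mulN1r.
Qed.

Lemma L2_sum (I : finType) (F : I -> Omega -> R) :
  (forall i, L2 (F i)) -> L2 (fun w => \sum_i F i w).
Proof.
move=> F2; rewrite /index_enum; elim: (Finite.enum I) => [|i s IHs].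
  by under eq_fun do rewrite big_nil; exact: L2_cst.
by under eq_fun do rewrite big_cons; exact: L2D.
Qed.

Lemma L2_le f g : measurable_fun setT f -> L1 g ->
  (forall w, f w ^+ 2 <= g w) -> L2 f.
Proof.
move=> mf gi fg; split => //; apply: L1_le gi _; first exact: measurable_funX.
by move=> w; rewrite ger0_norm ?sqr_ge0.
Qed.

Lemma Ex_sqr_sub a f g : L2 f -> L2 g -> Ex (fun w => f w * g w) = 0 ->
  Ex (fun w => (f w - a * g w) ^+ 2)
  = Ex (fun w => f w ^+ 2) + a ^+ 2 * Ex (fun w => g w ^+ 2).
Proof.
move=> f2 g2 fg0; have [[_ fi] [_ gi]] := (f2, g2).
have fgi := L2_mul f2 g2.
rewrite (@eq_Ex _ (fun w => f w ^+ 2 + ((- 2 * a) * (f w * g w) + a ^+ 2 * g w ^+ 2))).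
  rewrite ExD //; last by apply: L1D; exact: L1Z.
  by rewrite ExD ?ExZ //; try exact: L1Z; rewrite fg0 mulr0 add0r.
by move=> w; ring.
Qed.

(** [h] is orthogonal to the indicators of the events of [Y], hence to the
    simple functions of [Y]; the standard approximations of [phi] by simple
    functions are dominated by [phi]. *)
Let orthogonal_to_nonneg_fun h Y (phi : R -> R) : L1 h -> measurable_fun setT Y ->
  measurable_fun setT phi -> (forall y, 0 <= phi y) ->
  L1 (fun w => h w * phi (Y w)) ->
  (forall B : set R, measurable B -> Ex (fun w => h w * \1_(Y @^-1` B) w) = 0) ->
  Ex (fun w => h w * phi (Y w)) = 0.
Proof.
move=> hi mY mphi phi0 hphii hB.
have mE : measurable_fun setT (EFin \o phi) by exact/measurable_EFinP.
pose s := nnsfun_approx measurableT mE.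
have mYB (B : set R) : measurable B -> measurable (Y @^-1` B).
  by move=> mB; rewrite -[_ @^-1` _]setTI; exact: mY.
have phi0' x : [set: R] x -> (0 <= (EFin \o phi) x)%E by rewrite /= lee_fin.
have s_le k y : s k y <= phi y.
  by rewrite /s nnsfun_approxE -lee_fin; exact: le_approx.
have ms k : measurable_fun setT (fun w => h w * s k (Y w)).
  by apply: measurable_funM; [exact: L1_measurable | exact: measurableT_comp].
have hsi k : L1 (fun w => h w * s k (Y w)).
  apply: (@L1_le _ (fun w => `|h w * phi (Y w)|)) => //.
    exact: integrable_norm.
  move=> w; rewrite !normrM ler_wpM2l // ger0_norm; last exact: fun_ge0.
  by rewrite ger0_norm.
have Es k : (\int[P]_w (h w * s k (Y w))%:E = 0)%E.
  rewrite integral_Ex //; congr (_%:E).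
  have [m [c sE]] : exists m (c : 'I_m -> R), forall y,
      s k y = \sum_i c i * \1_(s k @^-1` [set c i]) y.
    pose r := finmap.enum_fset (fset_set (range (s k))).
    by exists (size r), (fun i => r`_i) => y; rewrite fimfunEord.
  rewrite (@eq_Ex _
    (fun w => \sum_i c i * (h w * \1_(Y @^-1` (s k @^-1` [set c i])) w))); last first.
    by move=> w; rewrite sE mulr_sumr; apply: eq_bigr => i _; rewrite mulrCA.
  have hi1 i : L1 (fun w => h w * \1_(Y @^-1` (s k @^-1` [set c i])) w).
    by apply: L1M_indic => //; exact/mYB/measurable_sfunP.
  rewrite Ex_sum => [|i]; last exact: L1Z.
  by rewrite big1 // => i _; rewrite ExZ ?hB ?mulr0 //; exact: measurable_sfunP.
have [] := @dominated_convergence _ _ _ P setT measurableT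
  (fun k w => (h w * s k (Y w))%:E) (fun w => (h w * phi (Y w))%:E)
  (fun w => `|h w * phi (Y w)|%:E).
- by move=> k; apply/measurable_EFinP.
- exact: measurable_int hphii.
- apply: aeW => w _; apply: cvg_EFin; first by near=> k.
  under eq_fun do rewrite /=.
  apply: cvgM; first exact: cvg_cst.
  have := @cvg_nnsfun_approx _ _ _ _ measurableT _ mE phi0' (Y w) I.
  by move/fine_cvg.
- exact: integrable_norm.
- apply: aeW => w k _; rewrite /= lee_fin !normrM ler_wpM2l // ger0_norm //.
  by rewrite ger0_norm.
move=> _ _; under [X in X @ _]eq_fun do rewrite Es.
move=> /cvg_lim; rewrite lim_cst //= => /(_ (@ereal_hausdorff _)) E0.
by rewrite /Ex /Rintegral -E0.
Unshelve. all: by end_near. Qed.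

(** Positive and negative parts of [Y] are nonnegative functions of [Y]. *)
Lemma orthogonal_to_preimages h Y : L1 h -> measurable_fun setT Y ->
  L1 (fun w => h w * Y w) ->
  (forall B : set R, measurable B -> Ex (fun w => h w * \1_(Y @^-1` B) w) = 0) ->
  Ex (fun w => h w * Y w) = 0.
Proof.
move=> hi mY hYi hB.
have mpos : measurable_fun [set: R] (fun y : R => Num.max y 0).
  exact: measurable_funrpos.
have mneg : measurable_fun [set: R] (fun y : R => Num.max (- y) 0).
  exact: (@measurable_funrneg _ _ _ _ id).
have posi : L1 (fun w => h w * Num.max (Y w) 0).
  apply: (@L1_le _ (fun w => `|h w * Y w|)); last 2 first.
  - exact: integrable_norm.
  - move=> w; rewrite !normrM ler_wpM2l // maxEle; case: ifP => // _.
    by rewrite normr0.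
  apply: measurable_funM; first exact: L1_measurable.
  exact: (measurableT_comp mpos).
have negi : L1 (fun w => h w * Num.max (- Y w) 0).
  apply: (@L1_le _ (fun w => `|h w * Y w|)); last 2 first.
  - exact: integrable_norm.
  - move=> w; rewrite !normrM ler_wpM2l // maxEle; case: ifP => _.
      by rewrite normr0.
    by rewrite normrN.
  apply: measurable_funM; first exact: L1_measurable.
  exact: (measurableT_comp mneg).
rewrite (@eq_Ex _ (fun w => h w * Num.max (Y w) 0 - h w * Num.max (- Y w) 0)).
  rewrite ExB // (orthogonal_to_nonneg_fun hi mY mpos) //; last first.
    by move=> y; rewrite le_max lexx orbT.
  rewrite (orthogonal_to_nonneg_fun hi mY mneg) ?subrr //.
  by move=> y; rewrite le_max lexx orbT.
move=> w; rewrite -mulrBr; congr (_ * _).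
rewrite !maxEle oppr_le0; case: leP => [y0|y0]; case: leP => y1; lra.
Qed.

End expectation.

(** * Conditional means and conditional independence *)

Section conditioning.
Context {d : measure_display} {Omega : measurableType d} {R : realType}.
Variable P : probability Omega R.
Implicit Types (f g h Y Z q : Omega -> R) (a : R).

Notation Ex := (Ex P).
Notation L1 := (L1 P).
Notation L2 := (L2 P).

Lemma integral_Ex_indic f (A : set Omega) : measurable A -> L1 f ->
  (\int[P]_(w in A) (f w)%:E)%E = (Ex (fun w => f w * \1_A w))%:E.
Proof.
move=> mA fi; rewrite integral_mkcond epatch_indic -integral_Ex //.
exact: L1M_indic.
Qed.

Lemma Ex_indic_bigcup h (F : (set Omega)^nat) : L1 h -> trivIset setT F ->
  (forall k, measurable (F k)) -> (forall k, Ex (fun w => h w * \1_(F k) w) = 0) ->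
  Ex (fun w => h w * \1_(\bigcup_k F k) w) = 0.
Proof.
move=> hi tF mF hF; have mU : measurable (\bigcup_k F k) by exact: bigcupT_measurable.
apply: EFin_inj; rewrite -integral_Ex_indic //.
have hi' : P.-integrable (\bigcup_k F k) (EFin \o h) by exact: integrableS hi.
rewrite integral_bigcup //.
by rewrite eseries0 // => k _ _; rewrite integral_Ex_indic // hF.
Qed.

(** The rectangles [A `*` B] are stable under intersection and generate the
    product sigma-algebra. *)
Lemma orthogonal_to_pair_events h {dS dT} {S : measurableType dS}
    {T : measurableType dT} (u : Omega -> S) (X : Omega -> T) :
  L1 h -> measurable_fun setT u -> measurable_fun setT X ->
  (forall A B, measurable A -> measurable B ->
     Ex (fun w => h w * \1_(u @^-1` A `&` X @^-1` B) w) = 0) ->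
  forall D : set (S * T), measurable D ->
    Ex (fun w => h w * \1_((fun w => (u w, X w)) @^-1` D) w) = 0.
Proof.
move=> hi mu mX hAB D mD; pose uX w := (u w, X w).
have muX : measurable_fun setT uX by exact: measurable_fun_pair.
have mpre (E : set (S * T)) : measurable E -> measurable (uX @^-1` E).
  by move=> mE; rewrite -[_ @^-1` _]setTI; exact: muX.
have h0 : Ex h = 0.
  rewrite -(hAB setT setT) //; apply: eq_Ex => w.
  by rewrite !preimage_setT setIT indicT mulr1.
rewrite measurable_prod_measurableType in mD; move: D mD.
apply: (@dynkin_induction _ (S * T)%type _
  (fun E => Ex (fun w => h w * \1_(uX @^-1` E) w) = 0)
  (measurable_prod_measurableType S T)).
- move=> _ _ [A1 mA1 [B1 mB1 <-]] [A2 mA2 [B2 mB2 <-]].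
  exists (A1 `&` A2); first exact: measurableI.
  by exists (B1 `&` B2); [exact: measurableI | rewrite setXI].
- by rewrite -h0; apply: eq_Ex => w; rewrite preimage_setT indicT mulr1.
- by move=> _ [A1 mA1 [B1 mB1 <-]]; exact: hAB.
- move=> E mE hE; rewrite -[RHS]subr0 -{1}h0 -{1}hE -ExB //.
    apply: eq_Ex => w; rewrite preimage_setC indicC /= indicE.
    by case: (_ \in _); rewrite /= ?mulr1 ?mulr0 ?subrr ?subr0.
  by apply: L1M_indic => //; exact: mpre.
- move=> F mF tF hF; rewrite preimage_bigcup; apply: Ex_indic_bigcup => //.
    by apply/trivIsetP => i j _ _ ij; move/trivIsetP: tF => /(_ i j I I ij);
      rewrite -preimage_setI => ->; rewrite preimage_set0.
  by move=> k; exact: mpre.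
Qed.

Variable G : set (set Omega).
Hypotheses (GT : G setT) (GI : setI_closed G) (G_measurable : G `<=` measurable).

Definition adapted Y := forall B : set R, measurable B -> G (Y @^-1` B).

(** [E[h | G] = 0], stated without choosing a version of the conditional mean. *)
Definition centered h :=
  L1 h /\ forall A, G A -> Ex (fun w => h w * \1_A w) = 0.

Lemma adapted_measurable Y : adapted Y -> measurable_fun setT Y.
Proof. by move=> GY _ B mB; rewrite setTI; exact/G_measurable/GY. Qed.

Lemma adapted_comp Y (phi : R -> R) : measurable_fun setT phi -> adapted Y ->
  adapted (phi \o Y).
Proof.
move=> mphi GY B mB; rewrite comp_preimage; apply: GY.
by rewrite -[_ @^-1` _]setTI; exact: mphi.
Qed.

Lemma centeredM h Y : centered h -> adapted Y -> L1 (fun w => h w * Y w) ->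
  Ex (fun w => h w * Y w) = 0.
Proof.
move=> [hi hG] GY hY; apply: orthogonal_to_preimages => //.
  exact: adapted_measurable.
by move=> B mB; exact/hG/GY.
Qed.

Lemma centered_Ex h : centered h -> Ex h = 0.
Proof.
move=> [hi hG]; rewrite -(hG setT GT); apply: eq_Ex => w.
by rewrite indicT mulr1.
Qed.

Lemma centered_indic h A : centered h -> G A -> centered (fun w => h w * \1_A w).
Proof.
move=> [hi hG] GA; split; first by apply: L1M_indic => //; exact: G_measurable.
move=> B GB; rewrite -(hG _ (GI GA GB)); apply: eq_Ex => w.
by rewrite indicI /= mulrA.
Qed.

Lemma centered_eq h g : h =1 g -> centered h -> centered g.
Proof. by move=> /funext ->. Qed.

Lemma centeredB h g : centered h -> centered g -> centered (fun w => h w - g w).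
Proof.
move=> [hi hG] [gi gG]; split; first exact: L1B.
move=> A GA; have mA := G_measurable GA.
rewrite (@eq_Ex _ _ _ P _ (fun w => h w * \1_A w - g w * \1_A w)); last first.
  by move=> w; rewrite mulrBl.
by rewrite ExB ?hG ?gG ?subrr //; exact: L1M_indic.
Qed.

Lemma centeredM_bounded h Y a : centered h -> adapted Y -> (forall w, `|Y w| <= a) ->
  centered (fun w => h w * Y w).
Proof.
move=> ch GY Ya; have mY := adapted_measurable GY.
split; first by case: ch => hi _; exact: L1M_bounded hi mY Ya.
move=> A GA; have cA := centered_indic ch GA.
rewrite -[RHS](centeredM cA GY); last by case: cA => hi _; exact: L1M_bounded hi mY Ya.
by apply: eq_Ex => w; rewrite mulrAC.
Qed.

Lemma cond_expectation_L1 Y Z : cond_expectation P G Y Z -> L1 Y -> L1 Z.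
Proof.
move=> [_ [mZ [//|Z0]] _ YZ] Yi; apply/integrableP; split; first exact/measurable_EFinP.
under eq_integral do rewrite /= ger0_norm //.
by rewrite -(YZ _ GT) integral_Ex // ltry.
Qed.

Lemma cond_expectation_centered Y Z : cond_expectation P G Y Z -> L1 Y -> L1 Z ->
  centered (fun w => Y w - Z w).
Proof.
move=> [_ _ _ YZ] Yi Zi; split; first exact: L1B.
move=> A GA; have mA := G_measurable GA.
rewrite (@eq_Ex _ _ _ P _ (fun w => Y w * \1_A w - Z w * \1_A w)); last first.
  by move=> w; rewrite mulrBl.
rewrite ExB; try exact: L1M_indic.
by apply/eqP; rewrite subr_eq0; apply/eqP/EFin_inj; rewrite -!integral_Ex_indic // YZ.
Qed.

Lemma Ex0_ae f : measurable_fun setT f -> (forall w, 0 <= f w) -> L1 f -> Ex f <= 0 ->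
  {ae P, forall w, f w = 0}.
Proof.
move=> mf f0 fi Ef.
have E0 : Ex f = 0 by apply/eqP; rewrite eq_le Ef Ex_ge0.
have mE : measurable_fun setT (EFin \o f) by exact/measurable_EFinP.
have /(ae_eq_integral_abs P measurableT mE) : (\int[P]_w `|(EFin \o f) w| = 0)%E.
  under eq_integral do rewrite /= ger0_norm //.
  by rewrite integral_Ex // E0.
by apply: filterS => w /(_ I) [].
Qed.

(** On the event where the constant is exceeded, the excess has integral zero. *)
Lemma ae_le_cst Z a : adapted Z -> L1 Z ->
  (forall A, G A -> Ex (fun w => (Z w - a) * \1_A w) <= 0) ->
  {ae P, forall w, Z w <= a}.
Proof.
move=> GZ Zi Za; pose A := Z @^-1` `]a, +oo[.
have GA : G A by exact: GZ.
have ZA w : 0 <= (Z w - a) * \1_A w.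
  rewrite indicE; case: (boolP (w \in A)) => [|_]; last by rewrite mulr0.
  by rewrite inE /A /= in_itv /= andbT mulr1 subr_ge0 => /ltW.
have iZa : L1 (fun w => (Z w - a) * \1_A w).
  by apply: L1M_indic; [exact: G_measurable | apply: L1B => //; exact: L1_cst].
have := Ex0_ae (L1_measurable iZa) ZA iZa (Za _ GA).
apply: filterS => w; rewrite leNgt; case: ltP => // aw.
by rewrite indicE mem_set /A /= ?in_itv /= ?aw // mulr1 => /eqP; rewrite subr_eq0 gt_eqF.
Qed.

Lemma cond_probability_01 (A : set Omega) q : measurable A ->
  cond_expectation P G \1_A q -> {ae P, forall w, 0 <= q w <= 1}.
Proof.
move=> mA Aq; have iA : L1 \1_A by exact: integrable_indic.
have iq := cond_expectation_L1 Aq iA; have [_ cAq] := cond_expectation_centered Aq iA iq.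
have Gq : adapted q by case: Aq.
have Eq (B : set Omega) : G B ->
    Ex (fun w => q w * \1_B w) = Ex (fun w => \1_A w * \1_B w).
  move=> GB; have mB := G_measurable GB.
  apply/esym/eqP; rewrite -subr_eq0 -ExB; try exact: L1M_indic.
  by apply/eqP; rewrite -[RHS](cAq _ GB); apply: eq_Ex => w; rewrite mulrBl.
have le1 : {ae P, forall w, q w <= 1}.
  apply: ae_le_cst => // B GB; have mB := G_measurable GB.
  rewrite (@eq_Ex _ _ _ P _ (fun w => q w * \1_B w - 1 * \1_B w)); last first.
    by move=> w; rewrite mulrBl.
  have i1B : L1 (fun w => 1 * \1_B w) by apply: L1M_indic => //; exact: L1_cst.
  rewrite ExB //; last exact: L1M_indic.
  rewrite Eq // subr_le0; apply: le_Ex => //; first exact: L1M_indic.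
  by move=> w; rewrite ler_wpM2r // (le_trans (ler_norm _)) // norm_indic_le1.
have ge0 : {ae P, forall w, - q w <= 0}.
  apply: ae_le_cst.
  - exact: (adapted_comp (@oppr_measurable R setT) Gq).
  - by apply: (eq_L1 _ (L1Z (-1) iq)) => w; rewrite mulN1r.
  move=> B GB; have mB := G_measurable GB.
  rewrite (@eq_Ex _ _ _ P _ (fun w => -1 * (q w * \1_B w))); last first.
    by move=> w; rewrite subr0 mulN1r mulNr.
  rewrite ExZ; last exact: L1M_indic.
  by rewrite Eq // mulN1r oppr_le0; apply: Ex_ge0 => w; rewrite mulr_ge0.
by apply: filterS2 le1 ge0 => w q1; rewrite oppr_le0 => ->.
Qed.

(** The comparison with constants is enough for the uniqueness that is needed:
    almost surely [q <= 1] and [- q <= -1]. *)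
Lemma cond_probability_setT q : cond_expectation P G \1_[set: Omega] q ->
  {ae P, forall w, q w = 1}.
Proof.
move=> Tq; have iT : L1 \1_[set: Omega] by exact: integrable_indic.
have iq := cond_expectation_L1 Tq iT; have [_ cTq] := cond_expectation_centered Tq iT iq.
have Gq : adapted q by case: Tq.
have ge1 : {ae P, forall w, - q w <= -1}.
  apply: ae_le_cst.
  - exact: (adapted_comp (@oppr_measurable R setT) Gq).
  - by apply: (eq_L1 _ (L1Z (-1) iq)) => w; rewrite mulN1r.
  move=> B GB; rewrite -[leRHS](cTq _ GB) le_eqVlt; apply/orP; left; apply/eqP.
  by apply: eq_Ex => w; rewrite indicT opprK addrC.
have := cond_probability_01 measurableT Tq.
apply: filterS2 ge1 => w; rewrite lerN2 => q1 /andP[_ q1'].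
by apply/eqP; rewrite eq_le q1 q1'.
Qed.

Lemma centered_ae h g : measurable_fun setT g -> L1 g ->
  {ae P, forall w, h w = g w} -> centered h -> centered g.
Proof.
move=> mg gi hg [hi hG]; split => // A GA; have mA := G_measurable GA.
rewrite -[RHS](hG _ GA); apply: EFin_inj; rewrite -!integral_Ex_indic //.
apply: ae_eq_integral => //.
- exact/measurable_EFinP/measurable_funTS.
- apply/measurable_EFinP/measurable_funTS; exact: L1_measurable hi.
- by apply: filterS hg => w hgw _; rewrite /= hgw.
Qed.

Definition clamp (r : R) : R := Num.min (Num.max r 0) 1.

Lemma clamp_id r : 0 <= r <= 1 -> clamp r = r.
Proof. by case/andP => r0 r1; rewrite /clamp max_l // min_l. Qed.

Lemma norm_clamp_le1 r : `|clamp r| <= 1.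
Proof.
rewrite /clamp ger0_norm; first by rewrite ge_min lexx orbT.
by rewrite le_min ler01 le_max lexx orbT.
Qed.

Lemma measurable_clamp : measurable_fun setT clamp.
Proof.
apply: measurable_minr; last exact: measurable_cst.
by apply: measurable_maxr; [exact: measurable_id | exact: measurable_cst].
Qed.

(** Versions of conditional probabilities lie in [0, 1] almost surely, and those
    of the sure event equal [1] almost surely; clamping gives bounded versions and
    discards the other factors of the product rule. *)
Lemma cond_independent_pair {dT} {T : measurableType dT} {n : nat}
    (X : 'I_n -> Omega -> T) (i j : 'I_n) (A B : set T) :
  (forall l, measurable_fun setT (X l)) -> cond_independent P G X -> i != j ->
  measurable A -> measurable B ->
  exists qi qj : Omega -> R,
  [/\ adapted qi /\ adapted qj, (forall w, `|qi w| <= 1) /\ (forall w, `|qj w| <= 1),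
      centered (fun w => \1_(X i @^-1` A) w - qi w),
      centered (fun w => \1_(X j @^-1` B) w - qj w)
    & centered (fun w => \1_(X i @^-1` A) w * \1_(X j @^-1` B) w - qi w * qj w)].
Proof.
move=> mX indep ij mA mB.
pose D l := if l == i then A else if l == j then B else setT.
have mD l : measurable (D l) by rewrite /D; case: eqP => // _; case: eqP.
have mpre l (E : set T) : measurable E -> measurable (X l @^-1` E).
  by move=> mE; rewrite -[_ @^-1` _]setTI; exact: mX.
have Di : D i = A by rewrite /D eqxx.
have Dj : D j = B by rewrite /D eqxx eq_sym (negbTE ij).
have [q [qP qprod]] := indep D mD.
pose cq l := clamp \o q l.
have mq l : adapted (q l) by case: (qP l).
have mcq l : adapted (cq l) by apply: adapted_comp => //; exact: measurable_clamp.
have mcq' l : measurable_fun setT (cq l) by exact: adapted_measurable.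
have iD l : L1 \1_(X l @^-1` D l) by apply: integrable_indic; exact: mpre.
have iq l : L1 (q l) by exact: cond_expectation_L1 (qP l) (iD l).
have icq l : L1 (cq l).
  by apply: L1_le (L1_cst P 1) _ => // w; exact: norm_clamp_le1.
have q_cq : {ae P, forall w, forall l, q l w = cq l w}.
  apply: filter_forall => l; have := cond_probability_01 (mpre l _ (mD l)) (qP l).
  by apply: filterS => w /clamp_id.
have q_prod : {ae P, forall w, \prod_l q l w = cq i w * cq j w}.
  have q1 : {ae P, forall w, forall l, l != i -> l != j -> q l w = 1}.
    apply: filter_forall => l; case: (boolP ((l != i) && (l != j))) => [/andP[li lj]|].
      have := qP l; rewrite /D (negbTE li) (negbTE lj) preimage_setT.
      by move/cond_probability_setT; apply: filterS.
    rewrite negb_and !negbK => lij; apply: aeW => w li lj.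
    by move: lij; rewrite (negbTE li) (negbTE lj).
  apply: filterS2 q_cq q1 => w qcq q1.
  rewrite (bigD1 i) // (bigD1 j) /=; last by rewrite eq_sym.
  by rewrite big1 ?mulr1 ?qcq // => l /andP[li lj]; exact: q1.
have centered_cq l : centered (fun w => \1_(X l @^-1` D l) w - cq l w).
  apply: centered_ae (cond_expectation_centered (qP l) (iD l) (iq l)).
  - by apply: measurable_funB => //; exact: L1_measurable (iD l).
  - exact: L1B.
  - by apply: filterS q_cq => w ->.
have cap : \bigcap_l (X l @^-1` D l) = X i @^-1` A `&` X j @^-1` B.
  apply/seteqP; split => w /= Dw.
    by split; [have := Dw i I; rewrite Di | have := Dw j I; rewrite Dj].
  move=> l _; rewrite /D; case: eqP => [->|_]; first by case: Dw.
  by case: eqP => [->|_ //]; case: Dw.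
exists (cq i), (cq j); split=> //.
- by split=> w; exact: norm_clamp_le1.
- by have := centered_cq i; rewrite Di.
- by have := centered_cq j; rewrite Dj.
have iAB : L1 \1_(X i @^-1` A `&` X j @^-1` B).
  by apply: integrable_indic; apply: measurableI; exact: mpre.
rewrite cap in qprod.
have iprod := cond_expectation_L1 qprod iAB.
have mcc : measurable_fun setT (fun w => cq i w * cq j w) by exact: measurable_funM.
have icc : L1 (fun w => cq i w * cq j w).
  by apply: L1M_bounded (icq i) (mcq' j) _ => w; exact: norm_clamp_le1.
apply: centered_ae (cond_expectation_centered qprod iAB iprod).
- apply: measurable_funB => //; apply: measurable_funM;
    by apply: measurable_indic; exact: mpre.
- apply: L1B => //; apply: (eq_L1 _ iAB) => w; by rewrite indicI.
- by apply: filterS q_prod => w ->; rewrite indicI.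
Qed.

(** Centering an event of [X i] keeps it centered on every event of [X j].  The
    centering [q] does not depend on the latter event, which is what allows
    [X j] to be replaced by functions of [X j] later on. *)
Lemma cond_independent_centered {dT} {T : measurableType dT} {n : nat}
    (X : 'I_n -> Omega -> T) (i j : 'I_n) (A : set T) :
  (forall l, measurable_fun setT (X l)) -> cond_independent P G X -> i != j ->
  measurable A ->
  exists q : Omega -> R,
  [/\ adapted q, forall w, `|q w| <= 1, centered (fun w => \1_(X i @^-1` A) w - q w)
    & forall B, measurable B ->
      centered (fun w => (\1_(X i @^-1` A) w - q w) * \1_(X j @^-1` B) w)].
Proof.
move=> mX indep ij mA.
have [q [_ [[Gq _] [q1 _] cq _ _]]] :=
  cond_independent_pair mX indep ij mA measurableT.
exists q; split=> // B mB.
have [qi [qj [[Gqi Gqj] [qi1 qj1] ci cj cij]]] :=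
  cond_independent_pair mX indep ij mA mB.
(* both [q] and [qi] are versions of the conditional probability of the event *)
have := centeredM_bounded (centeredB ci cq) Gqj qj1.
move=> /(centeredB (centeredB cij (centeredM_bounded cj Gq q1))).
by apply: centered_eq => w; ring.
Qed.

End conditioning.

Section uncorrelated.
Context {d : measure_display} {Omega : measurableType d} {R : realType}.
Variable P : probability Omega R.
Variable G : set (set Omega).
Hypotheses (GT : G setT) (GI : setI_closed G) (G_measurable : G `<=` measurable).
Context {dS dT} {S : measurableType dS} {T : measurableType dT} {n : nat}.
Variables (X : 'I_n -> Omega -> T) (u : 'I_n -> Omega -> S) (phi : 'I_n -> S * T -> R).
Hypotheses (mX : forall i, measurable_fun setT (X i)).
Hypothesis indep : cond_independent P G X.
Hypothesis Gu : forall i A, measurable A -> G (u i @^-1` A).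
Hypothesis mphi : forall i, measurable_fun setT (phi i).

Let mpre i (A : set T) : measurable A -> measurable (X i @^-1` A).
Proof. by move=> mA; rewrite -[_ @^-1` _]setTI; exact: mX. Qed.

Let mu i : measurable_fun setT (u i).
Proof. by move=> _ A mA; rewrite setTI; exact/G_measurable/Gu. Qed.

Let orthogonal_to_phi i h : L1 P h ->
  L1 P (fun w => h w * phi i (u i w, X i w)) ->
  (forall A B, G A -> measurable B ->
     Ex P (fun w => h w * \1_(A `&` X i @^-1` B) w) = 0) ->
  Ex P (fun w => h w * phi i (u i w, X i w)) = 0.
Proof.
move=> hi hphi hAB; apply: orthogonal_to_preimages => //.
  by apply: measurableT_comp => //; exact: measurable_fun_pair.
move=> B mB; apply: (orthogonal_to_pair_events hi (mu i) (mX i) _ (D := phi i @^-1` B)).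
  by move=> A C mA mC; apply: hAB => //; exact: Gu.
by rewrite -[_ @^-1` _]setTI; exact: mphi.
Qed.

(** Multiplying [E[N_j | G] = 0] by the indicator of an event of [X_i] does not
    change the conditional mean, because [N_j] is a function of [G] and [X_j]
    only; hence [N_j] is orthogonal to all functions of [G] and [X_i]. *)
Lemma cond_independent_uncorrelated (i j : 'I_n) (Zi Zj : Omega -> R) : i != j ->
  adapted G Zi -> adapted G Zj -> L2 P Zi -> L2 P Zj ->
  L2 P (fun w => phi i (u i w, X i w)) -> L2 P (fun w => phi j (u j w, X j w)) ->
  centered P G (fun w => phi j (u j w, X j w) - Zj w) ->
  Ex P (fun w => (phi i (u i w, X i w) - Zi w) * (phi j (u j w, X j w) - Zj w)) = 0.
Proof.
move=> ij GZi GZj Zi2 Zj2 Yi2 Yj2 cN.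
pose N w := phi j (u j w, X j w) - Zj w.
have N2 : L2 P N by exact: L2B.
have mN : measurable_fun setT N by case: N2.
have iN : L1 P N by exact: L2_L1.
suff NYi : Ex P (fun w => N w * phi i (u i w, X i w)) = 0.
  rewrite (@eq_Ex _ _ _ P _ (fun w => N w * phi i (u i w, X i w) - N w * Zi w)).
    rewrite ExB; try exact: L2_mul.
    by rewrite NYi (centeredM G_measurable cN GZi) ?subrr //; exact: L2_mul.
  by move=> w; rewrite mulrC mulrBr.
apply: orthogonal_to_phi => //; first exact: L2_mul.
move=> A B GA mB; have mA := G_measurable GA.
have [q [Gq q1 cq cqX]] := cond_independent_centered GT GI G_measurable mX indep ij mB.
pose h w := (\1_(X i @^-1` B) w - q w) * \1_A w.
have ch : centered P G h by exact: centered_indic.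
have ih : L1 P h by case: ch.
have h2 w : `|h w| <= 2.
  rewrite normrM -[leRHS]mulr1 ler_pM // ?norm_indic_le1 //.
  by apply: le_trans (ler_normB _ _) _; rewrite [leRHS](natrD _ 1 1) lerD ?norm_indic_le1.
have mh := L1_measurable ih.
have ihM f : L1 P f -> L1 P (fun w => h w * f w).
  by move=> fi; apply: eq_L1 (L1M_bounded fi mh h2) => w; rewrite mulrC.
have hN : Ex P (fun w => h w * N w) = 0.
  rewrite (@eq_Ex _ _ _ P _
    (fun w => h w * phi j (u j w, X j w) - h w * Zj w)); last by move=> w; rewrite mulrBr.
  rewrite ExB; try by apply: ihM; exact: L2_L1.
  rewrite (centeredM G_measurable ch GZj); last by apply: ihM; exact: L2_L1.
  rewrite subr0; apply: orthogonal_to_phi => //; first by apply: ihM; exact: L2_L1.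
  move=> C D GC mD; have [_ /(_ _ (GI GA GC)) <-] := cqX D mD.
  by apply: eq_Ex => w; rewrite /h !indicI /=; ring.
have NqA : Ex P (fun w => (N w * \1_A w) * q w) = 0.
  have cNA := centered_indic GI G_measurable cN GA.
  apply: (centeredM G_measurable cNA Gq).
  by case: cNA => iNA _; apply: L1M_bounded iNA _ q1; exact: adapted_measurable Gq.
rewrite -[RHS]addr0 -{1}hN -NqA -ExD.
- by apply: eq_Ex => w; rewrite /h indicI /=; ring.
- exact: ihM.
- apply: L1M_bounded q1; last exact: adapted_measurable Gq.
  exact: L1M_indic.
Qed.

End uncorrelated.

(** * Random vectors, histories and noise *)

Section row_vectors.
Context {d : measure_display} {Omega : measurableType d} {R : realType} {q : nat}.

Lemma measurable_coord (a : 'I_q) :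
  measurable_fun setT (fun u : 'rV[R]_q => u 0 a).
Proof.
move=> _ B mB; rewrite setTI; pose coord (i : 'I_q) (u : 'rV[R]_q) := u 0 i.
have gen : (\big[setU/set0]_(i < q) preimage_set_system setT (coord i) measurable)
    (coord a @^-1` B).
  rewrite -bigcup_seq; exists a; first by rewrite /= mem_index_enum.
  by exists B => //; rewrite setTI.
exact: sub_sigma_algebra gen.
Qed.

Lemma measurable_row_vector (v : Omega -> 'rV[R]_q) :
  (forall a, measurable_fun setT (fun w => v w 0 a)) -> measurable_fun setT v.
Proof.
move=> mv; pose coord (i : 'I_q) (u : 'rV[R]_q) := u 0 i.
have gen : measurable = <<s \big[setU/set0]_(i < q)
    preimage_set_system setT (coord i) measurable >> :> set (set 'rV[R]_q) by [].
have genP (B : set 'rV[R]_q) : (\big[setU/set0]_(i < q)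
    preimage_set_system setT (coord i) measurable) B ->
    exists a C, measurable C /\ coord a @^-1` C = B.
  by rewrite -bigcup_seq => -[a _ [C mC <-]]; exists a, C; rewrite setTI.
apply: (measurability _ gen) => _ [B /genP [a [C [mC <-]]] <-].
by have := mv a measurableT C mC.
Qed.

End row_vectors.

Section history.
Context {d : measure_display} {Omega : measurableType d} {R : realType} {n p : nat}.
Variable x : nat -> 'I_n -> Omega -> 'rV[R]_p.
Hypothesis mx : forall k i, measurable_fun setT (x k i).

Lemma history_setT k : history x k setT.
Proof. exact: (@measurableT _ (g_sigma_algebraType _)). Qed.

Lemma history_setI k : setI_closed (history x k).
Proof. by move=> A B; exact: (@measurableI _ (g_sigma_algebraType _)). Qed.

Lemma history_measurable k : history x k `<=` measurable.
Proof.
apply: smallest_sub; first exact: sigma_algebra_measurable.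
by move=> _ [l _ [i _ [A mA <-]]]; exact: mx.
Qed.

Lemma history_iterate k i (A : set 'rV[R]_p) : measurable A ->
  history x k (x k i @^-1` A).
Proof.
move=> mA; apply: sub_sigma_algebra; exists k => //=; exists i => //.
by exists A => //; rewrite setTI.
Qed.

End history.

Section vector_moments.
Context {d : measure_display} {Omega : measurableType d} {R : realType} {p : nat}.
Variable P : probability Omega R.
Implicit Types (u v N : Omega -> 'rV[R]_p) (a : R).

Definition vL2 v := forall c, L2 P (fun w => v w 0 c).

Definition Enorm2 v : R := Ex P (fun w => enorm (v w) ^+ 2).

Lemma L1_enorm v : vL2 v -> L1 P (fun w => enorm (v w) ^+ 2).
Proof.
move=> v2; apply: (@eq_L1 _ _ _ P (fun w => \sum_c v w 0 c ^+ 2)).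
  by move=> w; rewrite enorm_sqrE.
by apply: L1_sum => c; case: (v2 c).
Qed.

Lemma Enorm2E v : vL2 v -> Enorm2 v = \sum_c Ex P (fun w => v w 0 c ^+ 2).
Proof.
move=> v2; rewrite -Ex_sum; last by move=> c; case: (v2 c).
by apply: eq_Ex => w; rewrite enorm_sqrE.
Qed.

Lemma vL2_cst (z : 'rV[R]_p) : vL2 (fun=> z).
Proof. by move=> c; exact: L2_cst. Qed.

Lemma vL2D u v : vL2 u -> vL2 v -> vL2 (fun w => u w + v w).
Proof. by move=> u2 v2 c; under eq_fun do rewrite mxE; exact: L2D. Qed.

Lemma vL2Z a v : vL2 v -> vL2 (fun w => a *: v w).
Proof. by move=> v2 c; under eq_fun do rewrite mxE; exact: L2Z. Qed.

Lemma vL2B u v : vL2 u -> vL2 v -> vL2 (fun w => u w - v w).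
Proof. by move=> u2 v2 c; under eq_fun do rewrite !mxE; exact: L2B. Qed.

Lemma vL2_sum (I : finType) (v : I -> Omega -> 'rV[R]_p) :
  (forall i, vL2 (v i)) -> vL2 (fun w => \sum_i v i w).
Proof.
by move=> v2 c; under eq_fun do rewrite summxE; apply: L2_sum => i; exact: v2.
Qed.

(** As [N] will be centered, a vanishing mixed moment is a vanishing covariance;
    with square-integrability included, the class is stable under linear
    operations. *)
Definition uncorrelated N v :=
  vL2 v /\ forall c, Ex P (fun w => v w 0 c * N w 0 c) = 0.

Section closure.
Variable N : Omega -> 'rV[R]_p.
Hypothesis N2 : vL2 N.

Lemma uncorrelated_cst (z : 'rV[R]_p) : (forall c, Ex P (fun w => N w 0 c) = 0) ->
  uncorrelated N (fun=> z).
Proof.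
move=> N0; split=> [|c]; first exact: vL2_cst.
by rewrite ExZ ?N0 ?mulr0 //; exact: L2_L1.
Qed.

Lemma uncorrelatedD u v : uncorrelated N u -> uncorrelated N v ->
  uncorrelated N (fun w => u w + v w).
Proof.
move=> [u2 u0] [v2 v0]; split=> [|c]; first exact: vL2D.
rewrite -[RHS]addr0 -{1}(u0 c) -(v0 c) -ExD; try exact: L2_mul.
by apply: eq_Ex => w; rewrite mxE mulrDl.
Qed.

Lemma uncorrelatedZ a v : uncorrelated N v -> uncorrelated N (fun w => a *: v w).
Proof.
move=> [v2 v0]; split=> [|c]; first exact: vL2Z.
rewrite -[RHS](mulr0 a) -(v0 c) -ExZ; last exact: L2_mul.
by apply: eq_Ex => w; rewrite mxE mulrA.
Qed.

Lemma uncorrelatedB u v : uncorrelated N u -> uncorrelated N v ->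
  uncorrelated N (fun w => u w - v w).
Proof.
move=> cu cv; have := uncorrelatedD cu (uncorrelatedZ (-1) cv).
by under eq_fun do rewrite scaleN1r.
Qed.

Lemma uncorrelated_sum (I : finType) (v : I -> Omega -> 'rV[R]_p) :
  (forall i, uncorrelated N (v i)) -> uncorrelated N (fun w => \sum_i v i w).
Proof.
move=> cv; split=> [|c]; first by apply: vL2_sum => i; case: (cv i).
have -> : (fun w => (\sum_i v i w) 0 c * N w 0 c)
    = (fun w => \sum_i v i w 0 c * N w 0 c).
  by apply/funext => w; rewrite summxE mulr_suml.
rewrite Ex_sum; last by move=> i; apply: L2_mul => //; case: (cv i).
by rewrite big1 // => i _; case: (cv i).
Qed.

Lemma Enorm2_subZ a u : uncorrelated N u ->
  Enorm2 (fun w => u w - a *: N w) = Enorm2 u + a ^+ 2 * Enorm2 N.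
Proof.
move=> [u2 u0]; rewrite !Enorm2E //; last by apply: vL2B => //; exact: vL2Z.
rewrite mulr_sumr -big_split; apply: eq_bigr => c _ /=.
rewrite -(Ex_sqr_sub a (u2 c) (N2 c) (u0 c)); apply: eq_Ex => w.
by rewrite !mxE.
Qed.

End closure.

(** Pythagoras, coordinate by coordinate: the mixed terms vanish. *)
Lemma Enorm2_sum_uncorrelated (I : finType) (N : I -> Omega -> 'rV[R]_p) :
  (forall i, vL2 (N i)) -> (forall i j, i != j -> uncorrelated (N j) (N i)) ->
  Enorm2 (fun w => \sum_i N i w) = \sum_i Enorm2 (N i).
Proof.
move=> N2 Nij; rewrite Enorm2E; last exact: vL2_sum.
rewrite (eq_bigr (fun i => \sum_c Ex P (fun w => N i w 0 c ^+ 2))); last first.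
  by move=> i _; rewrite Enorm2E.
rewrite exchange_big; apply: eq_bigr => c _.
have -> : (fun w => (\sum_i N i w) 0 c ^+ 2)
    = (fun w => \sum_i \sum_j N i w 0 c * N j w 0 c).
  apply/funext => w; rewrite summxE expr2 mulr_suml; apply: eq_bigr => i _.
  by rewrite mulr_sumr.
have iN i j : L1 P (fun w => N i w 0 c * N j w 0 c) by apply: L2_mul; exact: N2.
rewrite Ex_sum; last by move=> i; apply: L1_sum => j; exact: iN.
apply: eq_bigr => i _; rewrite Ex_sum // (bigD1 i) //= big1 ?addr0.
  by apply: eq_Ex => w; rewrite expr2.
by move=> j ji; have [|_ ->] := Nij i j; rewrite 1?eq_sym.
Qed.

(** The conditional second moment is only assumed to have a version [V] that is
    integrable or nonnegative; its positive part is dominated by the bound in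
    both cases. *)
Lemma noise_moments (G : set (set Omega)) (Y Z : Omega -> 'rV[R]_p)
    (V : Omega -> R) (sigma M : R) :
  G setT -> setI_closed G -> G `<=` measurable -> 0 <= M ->
  (forall c, cond_expectation P G (fun w => Y w 0 c) (fun w => Z w 0 c)) ->
  cond_expectation P G (fun w => enorm (Y w - Z w) ^+ 2) V ->
  {ae P, forall w, V w <= sigma ^+ 2 + M * enorm (Z w) ^+ 2} ->
  vL2 Z ->
  [/\ vL2 (fun w => Y w - Z w),
      forall c, centered P G (fun w => Y w 0 c - Z w 0 c)
    & Enorm2 (fun w => Y w - Z w) <= sigma ^+ 2 + M * Enorm2 Z].
Proof.
move=> GT GI Gm M0 YZ [[msq _] [mV qV] _ sqV] Vb Z2.
pose b w := sigma ^+ 2 + M * enorm (Z w) ^+ 2.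
have ib : L1 P b by apply: L1D; [exact: L1_cst | apply: L1Z; exact: L1_enorm].
have mb : measurable_fun setT b by exact: L1_measurable ib.
have b0 w : 0 <= b w by rewrite addr_ge0 ?sqr_ge0 ?(mulr_ge0 M0 (sqr_ge0 _)).
pose Vp w := Num.max (V w) 0.
have mVp : measurable_fun setT Vp by apply: measurable_maxr.
have VVp : (\int[P]_w (V w)%:E <= \int[P]_w (Vp w)%:E)%E.
  case: qV => [iV|V0]; last first.
    by rewrite le_eqVlt; apply/orP; left; apply/eqP; apply: eq_integral => w _;
      rewrite /Vp max_l.
  have iVp : L1 P Vp.
    apply: (@L1_le _ _ _ P _ (fun w => `|V w|)) => //; first exact: integrable_norm.
    by move=> w; rewrite /Vp maxEle; case: ifP; rewrite ?normr0.
  by apply: le_integral => // w _; rewrite lee_fin /Vp le_max lexx.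
have Vpb : (\int[P]_w (Vp w)%:E <= \int[P]_w (b w)%:E)%E.
  apply: ae_ge0_le_integral => //; try exact/measurable_EFinP.
  - by move=> w _; rewrite lee_fin /Vp le_max lexx orbT.
  - by move=> w _; rewrite lee_fin.
  by apply: filterS Vb => w Vw _; rewrite lee_fin /Vp ge_max Vw b0.
have sq_le : (\int[P]_w (enorm (Y w - Z w) ^+ 2)%:E <= (Ex P b)%:E)%E.
  by rewrite (sqV _ GT) -integral_Ex //; apply: le_trans VVp Vpb.
have isq : L1 P (fun w => enorm (Y w - Z w) ^+ 2).
  apply/integrableP; split; first exact/measurable_EFinP.
  under eq_integral do rewrite /= ger0_norm ?sqr_ge0 //.
  by apply: le_lt_trans sq_le _; rewrite ltry.
have N2 : vL2 (fun w => Y w - Z w).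
  move=> c; apply: L2_le isq _.
    under eq_fun do rewrite !mxE; apply: measurable_funB.
      by case: (YZ c) => [[]].
    by case: (Z2 c).
  move=> w; rewrite enorm_sqrE (bigD1 c) //= lerDl; apply: sumr_ge0 => i _.
  exact: sqr_ge0.
split=> // [c|].
  apply: cond_expectation_centered => //; last exact: L2_L1.
  have := L2_L1 (L2D (N2 c) (Z2 c)); apply: eq_L1 => w.
  by rewrite !mxE subrK.
rewrite /Enorm2 -lee_fin -integral_Ex //.
apply: le_trans sq_le _; rewrite lee_fin /b ExD ?Ex_cst ?ExZ //.
- exact: L1_enorm.
- exact: L1_cst.
- by apply: L1Z; exact: L1_enorm.
Qed.

End vector_moments.

(** * One step of the algorithm in expectation *)

(** One step is described by the iterates [x], the gradients [D] at them and the
    noises [N]; only the first two moments of the noise are used. *)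
Section one_step.
Context {d : measure_display} {Omega : measurableType d} {R : realType} {n p : nat}.
Variable P : probability Omega R.
Variables (mu L sigma M alpha : R) (f : 'I_n -> 'rV[R]_p -> R) (xs : 'rV[R]_p).
Variables (e : rel 'I_n) (W : 'M[R]_n).
Variables (x N : 'I_n -> Omega -> 'rV[R]_p).
Hypotheses (mu_gt0 : 0 < mu) (mu_le_L : mu <= L) (M_gt0 : 0 < M) (alpha_gt0 : 0 < alpha).
Hypothesis n_gt0 : (0 < n)%N.
Hypothesis f_scs : forall i, strongly_convex_smooth mu L (f i).
Hypothesis W_mix : mixing_matrix e W.

Let D i w := gradient (f i) (x i w).

Hypotheses (x2 : forall i, vL2 P (x i)) (D2 : forall i, vL2 P (D i)).
Hypotheses (N2 : forall i, vL2 P (N i)) (N_mean : forall i c, Ex P (fun w => N i w 0 c) = 0).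
Hypothesis N_var : forall i, Enorm2 P (N i) <= sigma ^+ 2 + M * Enorm2 P (D i).
Hypothesis xN : forall i j, uncorrelated P (N i) (x j).
Hypothesis DN : forall i j, uncorrelated P (N i) (D j).
Hypothesis NN : forall i j, i != j -> uncorrelated P (N j) (N i).

Let L_gt0 : 0 < L. Proof. exact: lt_le_trans mu_le_L. Qed.
Let nR_gt0 : 0 < n%:R :> R. Proof. by rewrite ltr0n. Qed.

Let local i w := x i w - alpha *: (D i w + N i w).
Let next i w := \sum_j W i j *: local j w.
Let mean w := average (fun i => x i w).

Definition total2 (v : 'I_n -> Omega -> 'rV[R]_p) : R :=
  Ex P (fun w => \sum_i enorm (v i w) ^+ 2).

Lemma total2E (v : 'I_n -> Omega -> 'rV[R]_p) :
  (forall i, vL2 P (v i)) -> total2 v = \sum_i Enorm2 P (v i).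
Proof. by move=> v2; rewrite /total2 Ex_sum // => i; exact: L1_enorm. Qed.

Lemma L1_total (v : 'I_n -> Omega -> 'rV[R]_p) :
  (forall i, vL2 P (v i)) -> L1 P (fun w => \sum_i enorm (v i w) ^+ 2).
Proof. by move=> v2; apply: L1_sum => i; exact: L1_enorm. Qed.

Lemma uncorrelated_average (Z : Omega -> 'rV[R]_p) (v : 'I_n -> Omega -> 'rV[R]_p) :
  vL2 P Z -> (forall i, uncorrelated P Z (v i)) ->
  uncorrelated P Z (fun w => average (fun i => v i w)).
Proof.
by move=> Z2 vZ; rewrite /average; apply: uncorrelatedZ => //; apply: uncorrelated_sum.
Qed.

(** The noise is uncorrelated with the noiseless step [U], so its variance is
    added; the part of the variance proportional to the gradient is kept inside
    the sum, where the deterministic estimates absorb it. *)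
Let total2_noisy (U : 'I_n -> Omega -> 'rV[R]_p) :
  (forall i, uncorrelated P (N i) (U i)) ->
  total2 (fun i w => U i w - alpha *: N i w)
  <= Ex P (fun w => \sum_i (enorm (U i w) ^+ 2 + alpha ^+ 2 * M * enorm (D i w) ^+ 2))
     + alpha ^+ 2 * (n%:R * sigma ^+ 2).
Proof.
move=> UN; have U2 i : vL2 P (U i) by case: (UN i).
have iD i : L1 P (fun w => alpha ^+ 2 * M * enorm (D i w) ^+ 2).
  by apply: L1Z; exact: L1_enorm.
rewrite total2E; last by move=> i; apply: vL2B => //; exact: vL2Z.
rewrite Ex_sum; last by move=> i; apply: L1D => //; exact: L1_enorm.
have -> : alpha ^+ 2 * (n%:R * sigma ^+ 2) = \sum_(i < n) alpha ^+ 2 * sigma ^+ 2.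
  by rewrite sumr_const card_ord -[RHS]mulr_natl mulrCA.
rewrite -big_split; apply: ler_sum => i _ /=.
rewrite Enorm2_subZ // ExD //; last exact: L1_enorm.
rewrite ExZ; last exact: L1_enorm.
have := ler_wpM2l (sqr_ge0 alpha) (N_var i); rewrite /Enorm2; lra.
Qed.

(** Rows of [W] sum to 1, so [xs] may be subtracted before mixing. *)
Lemma total_distance_step : 2 * alpha * (1 + M) * L ^+ 2 <= mu ->
  total2 (fun i w => next i w - xs)
  <= (1 - alpha * mu / 2) * total2 (fun i w => x i w - xs)
     + 3 * alpha / mu * Bconst f xs + alpha ^+ 2 * (n%:R * sigma ^+ 2).
Proof.
move=> aM; pose U i w := x i w - alpha *: D i w - xs.
have cst_i i : uncorrelated P (N i) (fun=> xs) by apply: uncorrelated_cst.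
have UN i : uncorrelated P (N i) (U i).
  by apply: uncorrelatedB => //; apply: uncorrelatedB => //; exact: uncorrelatedZ.
have local2 i : vL2 P (local i) by apply: vL2B => //; apply: vL2Z; exact: vL2D.
have U2 i : vL2 P (U i) by case: (UN i).
have UE i w : U i w - alpha *: N i w = local i w - xs.
  by rewrite /U /local scalerDr opprD addrA [LHS]addrAC.
apply: (@le_trans _ _ (total2 (fun i w => U i w - alpha *: N i w))).
  apply: le_Ex.
  - by apply: L1_total => i; apply: vL2B; [apply: vL2_sum => j; exact: vL2Z | exact: vL2_cst].
  - by apply: L1_total => i; apply: vL2B => //; exact: vL2Z.
  move=> w; apply: le_trans (mixing_contracts (fun i => U i w - alpha *: N i w) W_mix).
  rewrite le_eqVlt; apply/orP; left; apply/eqP; apply: eq_bigr => i _.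
  congr (enorm _ ^+ 2); rewrite (eq_bigr (fun j => W i j *: local j w - W i j *: xs)).
    by rewrite sumrB -scaler_suml (mixing_row_sum i W_mix) scale1r.
  by move=> j _; rewrite UE scalerBr.
apply: le_trans (total2_noisy UN) _; rewrite lerD2r.
have x2s i : vL2 P (fun w => x i w - xs) by apply: vL2B => //; exact: vL2_cst.
rewrite /total2 -ExZ; last exact: L1_total.
rewrite -[X in _ <= _ + X](Ex_cst P) -ExD; last 2 first.
- by apply: L1Z; exact: L1_total.
- exact: L1_cst.
apply: le_Ex.
- by apply: L1_sum => i; apply: L1D; [exact: L1_enorm | apply: L1Z; exact: L1_enorm].
- by apply: L1D; [apply: L1Z; exact: L1_total | exact: L1_cst].
move=> w; rewrite /Bconst !mulr_sumr -big_split; apply: ler_sum => i _.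
exact: (local_step_le f_scs i (x i w) xs mu_gt0 mu_le_L M_gt0 (ltW alpha_gt0) aM).
Qed.

Lemma total_gradient_le (Xh : R) : total2 (fun i w => x i w - xs) <= Xh ->
  total2 D <= 2 * L ^+ 2 * Xh + 2 * Bconst f xs.
Proof.
move=> XXh; have x2s i : vL2 P (fun w => x i w - xs).
  by apply: vL2B => //; exact: vL2_cst.
apply: (@le_trans _ _ (2 * L ^+ 2 * total2 (fun i w => x i w - xs) + 2 * Bconst f xs)).
  rewrite /total2 -ExZ; last exact: L1_total.
  rewrite -[X in _ <= _ + X](Ex_cst P) -ExD; last 2 first.
  - by apply: L1Z; exact: L1_total.
  - exact: L1_cst.
  apply: le_Ex; first exact: L1_total.
    by apply: L1D; [apply: L1Z; exact: L1_total | exact: L1_cst].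
  move=> w; rewrite /Bconst !mulr_sumr -big_split; apply: ler_sum => i _ /=.
  have := enormD_sqr_le (D i w - gradient (f i) xs) (gradient (f i) xs) ltr01.
  have := gradient_lipschitz f_scs i (x i w) xs (ltW L_gt0).
  by rewrite subrK invr1 -/(D i w); lra.
by rewrite lerD2r ler_wpM2l // mulr_ge0 // sqr_ge0.
Qed.

Lemma disagreement_step (Xh : R) : rho W < 1 ->
  total2 (fun i w => x i w - xs) <= Xh ->
  total2 (fun i w => next i w - average (next^~ w))
  <= (1 - (1 - rho W ^+ 2) / 2) * total2 (fun i w => x i w - mean w)
     + alpha ^+ 2 * (((3 + M) * (2 * L ^+ 2 * Xh + 2 * Bconst f xs) + n%:R * sigma ^+ 2)
                     / (1 - rho W ^+ 2)).
Proof.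
move=> rho1 XXh; set r2 := rho W ^+ 2.
have rho0 : 0 <= rho W by exact: spectral_norm_ge0.
have r20 : 0 <= r2 by exact: sqr_ge0.
have r21 : r2 < 1 by rewrite expr_lt1.
have gap : 0 < 1 - r2 by rewrite subr_gt0.
pose U i w := (x i w - mean w) - alpha *: D i w.
have meanN i : uncorrelated P (N i) mean by exact: uncorrelated_average.
have UN i : uncorrelated P (N i) (U i).
  apply: uncorrelatedB => //; last exact: uncorrelatedZ.
  exact: uncorrelatedB.
have local2 i : vL2 P (local i) by apply: vL2B => //; apply: vL2Z; exact: vL2D.
have U2 i : vL2 P (U i) by case: (UN i).
have mean2 : vL2 P mean by apply: vL2Z; exact: vL2_sum.
have dev2 i : vL2 P (fun w => x i w - mean w) by exact: vL2B.
have next2 i : vL2 P (next i) by apply: vL2_sum => j; exact: vL2Z.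
have UE i w : U i w - alpha *: N i w = local i w - mean w.
  by rewrite /U /local scalerDr opprD addrA [x i w - mean w - _]addrAC [LHS]addrAC.
have contr : total2 (fun i w => next i w - average (next^~ w))
    <= r2 * total2 (fun i w => U i w - alpha *: N i w).
  have iU : L1 P (fun w => \sum_i enorm (U i w - alpha *: N i w) ^+ 2).
    by apply: L1_total => i; apply: vL2B => //; exact: vL2Z.
  rewrite /total2 -ExZ //; apply: le_Ex; last 1 first.
  - move=> w; under eq_bigr => i _.
      rewrite [_ - _](mix_sub_average (local^~ w) (mean w) i n_gt0 W_mix).
      under eq_bigr => j _ do rewrite -UE.
    over.
    exact: spectral_contracts.
  - apply: L1_total => i; apply: vL2B => //.
    by apply: vL2Z; exact: vL2_sum.
  - exact: L1Z.
apply: le_trans contr _.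
have iD : L1 P (fun w => \sum_i enorm (D i w) ^+ 2) by exact: L1_total.
have idev : L1 P (fun w => \sum_i enorm (x i w - mean w) ^+ 2) by exact: L1_total.
have bound : total2 (fun i w => U i w - alpha *: N i w)
    <= (1 + (1 - r2) / 2) * total2 (fun i w => x i w - mean w)
       + alpha ^+ 2 * (3 / (1 - r2) + M) * total2 D + alpha ^+ 2 * (n%:R * sigma ^+ 2).
  apply: le_trans (total2_noisy UN) _; rewrite lerD2r /total2 -!ExZ // -ExD; last 2 first.
  - exact: L1Z.
  - exact: L1Z.
  apply: le_Ex.
  - by apply: L1_sum => i; apply: L1D; [exact: L1_enorm | apply: L1Z; exact: L1_enorm].
  - by apply: L1D; exact: L1Z.
  move=> w; rewrite !mulr_sumr -big_split; apply: ler_sum => i _.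
  exact: disagreement_step_le.
have {}bound := le_trans (ler_wpM2l r20 bound) (lexx _).
apply: le_trans bound _.
have V0 : 0 <= total2 (fun i w => x i w - mean w).
  by apply: Ex_ge0 => w; apply: sumr_ge0 => i _; exact: sqr_ge0.
have D0 : 0 <= total2 D.
  by apply: Ex_ge0 => w; apply: sumr_ge0 => i _; exact: sqr_ge0.
have hD := total_gradient_le XXh.
set V := total2 _ in V0 *; set DD := total2 D in D0 hD *.
set Db := 2 * L ^+ 2 * Xh + _ in hD *; set S := n%:R * sigma ^+ 2.
have S0 : 0 <= S by rewrite mulr_ge0 ?sqr_ge0.
have a2 : 0 <= alpha ^+ 2 by exact: sqr_ge0.
have Vle : r2 * ((1 + (1 - r2) / 2) * V) <= (1 - (1 - r2) / 2) * V.
  by rewrite mulrA ler_wpM2r //; nra.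
have Qle : r2 * ((3 / (1 - r2) + M) * DD + S) <= ((3 + M) * Db + S) / (1 - r2).
  apply: (@le_trans _ _ ((3 / (1 - r2) + M) * DD + S)).
    rewrite ler_piMl ?(ltW r21) // addr_ge0 // mulr_ge0 // addr_ge0 ?(ltW M_gt0) //.
    by rewrite divr_ge0 // ltW.
  rewrite [leRHS]mulrDl lerD //; last first.
    by rewrite ler_peMr // invf_ge1 // gerBl.
  rewrite [leRHS]mulrAC ler_pM // ?addr_ge0 ?(ltW M_gt0) ?divr_ge0 ?(ltW gap) //.
  by rewrite [leRHS]mulrDl lerD2l ler_peMr ?(ltW M_gt0) // invf_ge1 // gerBl.
have := ler_wpM2l a2 Qle; lra.
Qed.

(** Averaging [n] uncorrelated noises divides the sum of their variances by
    [n ^ 2]; with the bound [Xh] on the total distance the result is [c2 / n]. *)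
Lemma mean_step (Xh A : R) : 4 * alpha * L ^+ 2 <= mu ->
  average (fun i => gradient (f i) xs) = 0 ->
  Xh = Xhat mu L sigma M n A (Bconst f xs) ->
  total2 (fun i w => x i w - xs) <= Xh ->
  Enorm2 P (fun w => average (next^~ w) - xs)
  <= (1 - 3 / 2 * (alpha * mu)) * Enorm2 P (fun w => mean w - xs)
     + 5 * alpha * L ^+ 2 / (n%:R * mu) * total2 (fun i w => x i w - mean w)
     + alpha ^+ 2 * (c2 mu L sigma M n A (Bconst f xs) / n%:R).
Proof.
move=> aL grad0 XhE XXh.
pose U w := mean w - xs - alpha *: average (fun i => D i w).
pose Nb w := average (fun i => N i w).
have meanN i : uncorrelated P (N i) mean by exact: uncorrelated_average.
have Nb2 : vL2 P Nb by apply: vL2Z; exact: vL2_sum.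
have UNi i : uncorrelated P (N i) U.
  apply: uncorrelatedB => //; last by apply: uncorrelatedZ => //; exact: uncorrelated_average.
  by apply: uncorrelatedB => //; apply: uncorrelated_cst.
have U2 : vL2 P U by case: (UNi (Ordinal n_gt0)).
have UN : uncorrelated P Nb U.
  split=> // c; rewrite (@eq_Ex _ _ _ P _
    (fun w => n%:R^-1 * \sum_i (U w 0 c * N i w 0 c))); last first.
    by move=> w; rewrite [Nb w 0 c]mxE summxE -mulr_sumr mulrCA.
  have iUN i : L1 P (fun w => U w 0 c * N i w 0 c) by exact: L2_mul (U2 c) (N2 i c).
  rewrite ExZ; last exact: L1_sum.
  by rewrite Ex_sum // big1 ?mulr0 // => i _; case: (UNi i).
have nextE w : average (next^~ w) - xs = U w - alpha *: Nb w.
  rewrite (average_mix (local^~ w) W_mix) /U /Nb /mean /local.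
  rewrite [LHS](_ : _ = average (x^~ w) - alpha *: average (D^~ w)
    - alpha *: average (N^~ w) - xs); last first.
    congr (_ - _); rewrite /average sumrB scalerBr -addrA -opprD; congr (_ - _).
    by rewrite -scaler_sumr big_split scalerA [_ * alpha]mulrC -scalerA !scalerDr.
  by rewrite [LHS]addrAC; congr (_ - _); rewrite addrAC.
have -> : Enorm2 P (fun w => average (next^~ w) - xs)
    = Enorm2 P (fun w => U w - alpha *: Nb w).
  by apply: eq_Ex => w; rewrite nextE.
rewrite Enorm2_subZ //.
have mean2 : vL2 P mean by case: (meanN (Ordinal n_gt0)).
have mean2s : vL2 P (fun w => mean w - xs) by apply: vL2B => //; exact: vL2_cst.
have dev2 i : vL2 P (fun w => x i w - mean w) by exact: vL2B.
apply: lerD.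
  rewrite /Enorm2 /total2 -!ExZ; last 2 first.
  - exact: L1_enorm.
  - exact: L1_total.
  have i1 : L1 P (fun w => (1 - 3 / 2 * (alpha * mu)) * enorm (mean w - xs) ^+ 2).
    by apply: L1Z; exact: L1_enorm.
  have i2 : L1 P (fun w => 5 * alpha * L ^+ 2 / (n%:R * mu)
      * \sum_i enorm (x i w - mean w) ^+ 2) by apply: L1Z; exact: L1_total.
  rewrite -ExD //; apply: le_Ex; [exact: L1_enorm | exact: L1D |].
  by move=> w; exact: mean_step_le.
rewrite ler_wpM2l ?sqr_ge0 //.
have -> : Enorm2 P Nb = n%:R^-1 ^+ 2 * \sum_i Enorm2 P (N i).
  rewrite -Enorm2_sum_uncorrelated // /Enorm2 -ExZ; last first.
    by apply: L1_enorm; exact: vL2_sum.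
  by apply: eq_Ex => w; rewrite /Nb /average enormZ_sqr.
have hD := total_gradient_le XXh; rewrite total2E // in hD.
have hN : \sum_i Enorm2 P (N i)
    <= n%:R * sigma ^+ 2 + M * (2 * L ^+ 2 * Xh + 2 * Bconst f xs).
  apply: le_trans (ler_sum _ (fun i _ => N_var i)) _.
  rewrite big_split /= sumr_const card_ord -[sigma ^+ 2 *+ n]mulr_natl -mulr_sumr.
  by rewrite lerD2l ler_wpM2l // ltW.
apply: le_trans (ler_wpM2l (sqr_ge0 _) hN) _.
rewrite /c2 /Mbar -XhE le_eqVlt; apply/orP; left; apply/eqP.
by field; rewrite gt_eqF.
Qed.

End one_step.

(** * Size of the remainder *)

Section remainder.
Context {R : realType} (theta mu L sigma M : R).
Hypotheses (theta_gt2 : 2 < theta) (mu_gt0 : 0 < mu) (L_gt0 : 0 < L) (M_gt0 : 0 < M).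

Let K := Kconst theta mu L M.

(** [(1 - rho_w ^ 2)] times the noise level of the disagreement recursion, when the
    total squared distance to the minimizer is at most [Xh]. *)
Definition gradient_bound (n : nat) (Xh B : R) : R :=
  (3 + M) * (2 * L ^+ 2 * Xh + 2 * B) + n%:R * sigma ^+ 2.

(** The first term covers the state at time [K1], the second one the noise. *)
Definition disagreement_constant (K1 n : nat) (rho_w Xh B : R) : R :=
  K1%:R ^+ 2 * Xh
  + 3 * theta ^+ 2 * gradient_bound n Xh B / (mu ^+ 2 * (1 - rho_w ^+ 2) ^+ 2).

Definition remainder_constant (K1 n : nat) (rho_w Xh B : R) : R :=
  K1%:R ^+ 2 * Xh / n%:R
  + 5 * theta * L ^+ 2 * disagreement_constant K1 n rho_w Xh B / (n%:R * mu ^+ 2).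

Let X_factor : R := 1 + 9 / mu ^+ 2 + sigma ^+ 2 / ((1 + M) * L ^+ 2).
Let Q_factor : R := (3 + M) * (2 * L ^+ 2 * X_factor + 2) + sigma ^+ 2.
Let K_factor : R := 2 * K%:R + 17.
Let V_factor : R := K_factor ^+ 2 * X_factor + 3 * theta ^+ 2 * Q_factor / mu ^+ 2.

(** Built from [theta], [mu], [L], [sigma] and [M] only: this is the constant
    hidden in the asymptotic notation. *)
Definition remainder_factor : R :=
  K_factor ^+ 2 * X_factor + 5 * theta * L ^+ 2 * V_factor / mu ^+ 2.

Let theta_gt0 : 0 < theta. Proof. exact: lt_trans theta_gt2. Qed.

Lemma Xhat_ge0 (n : nat) (A B : R) : 0 <= A -> 0 <= Xhat mu L sigma M n A B.
Proof. by move=> A0; rewrite le_max A0. Qed.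

Lemma Xhat_le (n : nat) (A B : R) : 0 <= A -> 0 <= B ->
  Xhat mu L sigma M n A B <= X_factor * (A + B + n%:R).
Proof.
move=> A0 B0; have n0 : 0 <= n%:R :> R by [].
have a1 : 0 <= 9 / mu ^+ 2 by rewrite divr_ge0 // sqr_ge0.
have b1 : 0 <= sigma ^+ 2 / ((1 + M) * L ^+ 2).
  by rewrite divr_ge0 ?sqr_ge0 // mulr_ge0 ?sqr_ge0 // addr_ge0 // ltW.
rewrite /Xhat ge_max /X_factor.
have -> : 9 * B / mu ^+ 2 = 9 / mu ^+ 2 * B by ring.
have -> : n%:R * sigma ^+ 2 / ((1 + M) * L ^+ 2)
    = sigma ^+ 2 / ((1 + M) * L ^+ 2) * n%:R by ring.
move: a1 b1; set a := 9 / _; set b := sigma ^+ 2 / _ => a1 b1.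
have := mulr_ge0 a1 A0; have := mulr_ge0 a1 B0; have := mulr_ge0 a1 n0.
have := mulr_ge0 b1 A0; have := mulr_ge0 b1 B0; have := mulr_ge0 b1 n0.
by move=> *; apply/andP; split; lra.
Qed.

Lemma gradient_bound_ge0 (n : nat) (Xh B : R) : 0 <= Xh -> 0 <= B ->
  0 <= gradient_bound n Xh B.
Proof.
move=> Xh0 B0; apply: addr_ge0; last exact: mulr_ge0 (ler0n _ _) (sqr_ge0 _).
have m3 : 0 <= 3 + M by rewrite addr_ge0 // ltW.
apply: mulr_ge0 m3 (addr_ge0 _ (mulr_ge0 (ler0n _ _) B0)).
exact: mulr_ge0 (mulr_ge0 (ler0n _ _) (sqr_ge0 L)) Xh0.
Qed.

Lemma disagreement_constant_ge0 (K1 n : nat) (rho_w Xh B : R) : 0 <= Xh -> 0 <= B ->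
  0 <= disagreement_constant K1 n rho_w Xh B.
Proof.
move=> Xh0 B0; have Q0 := gradient_bound_ge0 n Xh0 B0.
apply: addr_ge0; first exact: mulr_ge0 (sqr_ge0 _) Xh0.
apply: divr_ge0; last exact: mulr_ge0 (sqr_ge0 _) (sqr_ge0 _).
exact: mulr_ge0 (mulr_ge0 (ler0n _ _) (sqr_ge0 _)) Q0.
Qed.

Lemma remainder_constant_ge0 (K1 n : nat) (rho_w Xh B : R) : 0 <= Xh -> 0 <= B ->
  0 <= remainder_constant K1 n rho_w Xh B.
Proof.
move=> Xh0 B0; have V0 := disagreement_constant_ge0 K1 n rho_w Xh0 B0.
have h : 0 <= 5 * theta * L ^+ 2 by rewrite !mulr_ge0 // ltW.
have h' : 0 <= n%:R * mu ^+ 2 by rewrite mulr_ge0 // sqr_ge0.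
apply: addr_ge0; last exact: divr_ge0 (mulr_ge0 h V0) h'.
by rewrite divr_ge0 // mulr_ge0 // sqr_ge0.
Qed.

(** [1 - rho ^ 2 >= 1 - rho] and [K1 (1 - rho)] is bounded by a constant. *)
Lemma remainder_constant_le (n : nat) (A B rho_w : R) :
  (0 < n)%N -> 0 <= A -> 0 <= B -> 0 <= rho_w -> rho_w < 1 ->
  remainder_constant (K1const theta mu L M rho_w) n rho_w (Xhat mu L sigma M n A B) B
  <= remainder_factor * ((A + B + n%:R) / (n%:R * (1 - rho_w) ^+ 2)).
Proof.
move=> n0 A0 B0 r0 r1; have nR : 0 < n%:R :> R by rewrite ltr0n.
set K1 := K1const _ _ _ _ _; set T := A + B + n%:R; set s := 1 - rho_w.
have s0 : 0 < s by rewrite subr_gt0.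
set Xh := Xhat _ _ _ _ _ _ _.
have Xh0 : 0 <= Xh by exact: Xhat_ge0.
have XT : Xh <= X_factor * T by exact: Xhat_le.
have T0 : 0 <= T by rewrite !addr_ge0.
have BT : B <= T by rewrite /T; have := ltW nR; lra.
have nT : n%:R <= T by rewrite /T; lra.
have QT : gradient_bound n Xh B <= Q_factor * T.
  have L2 : 0 <= L ^+ 2 by exact: sqr_ge0.
  have := ler_wpM2l L2 XT; have := ler_wpM2l (sqr_ge0 sigma) nT.
  rewrite /gradient_bound /Q_factor => h1 h2; rewrite [leRHS]mulrDl lerD //; last by rewrite mulrC.
  by rewrite -[leRHS]mulrA ler_wpM2l ?addr_ge0 ?(ltW M_gt0) //; lra.
have K1s : K1%:R ^+ 2 * Xh <= K_factor ^+ 2 * X_factor * (T / s ^+ 2).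
  have -> : K_factor ^+ 2 * X_factor * (T / s ^+ 2) = (K_factor / s) ^+ 2 * (X_factor * T).
    by field; rewrite gt_eqF.
  have K1le : K1%:R <= K_factor / s by exact: K1const_le.
  by rewrite ler_pM ?sqr_ge0 // ler_sqr ?nnegrE // (le_trans _ K1le).
have gs : s ^+ 2 <= (1 - rho_w ^+ 2) ^+ 2.
  have : s <= 1 - rho_w ^+ 2 by rewrite lerD2l lerN2 expr2 ler_piMr // ltW.
  by move=> h; rewrite ler_sqr ?nnegrE ?(ltW s0) // (le_trans (ltW s0)).
have g0 : 0 < (1 - rho_w ^+ 2) ^+ 2 by apply: lt_le_trans gs; rewrite exprn_gt0.
have VT : disagreement_constant K1 n rho_w Xh B <= V_factor * (T / s ^+ 2).
  rewrite /disagreement_constant /V_factor [leRHS]mulrDl lerD //.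
  have -> : 3 * theta ^+ 2 * Q_factor / mu ^+ 2 * (T / s ^+ 2)
      = 3 * theta ^+ 2 / mu ^+ 2 * (Q_factor * T / s ^+ 2).
    by field; rewrite !gt_eqF.
  have -> : 3 * theta ^+ 2 * gradient_bound n Xh B / (mu ^+ 2 * (1 - rho_w ^+ 2) ^+ 2)
      = 3 * theta ^+ 2 / mu ^+ 2 * (gradient_bound n Xh B / (1 - rho_w ^+ 2) ^+ 2).
    move: g0; move: ((1 - _) ^+ 2) => g g0.
    by field; rewrite !gt_eqF.
  have tm : 0 <= 3 * theta ^+ 2 / mu ^+ 2 by rewrite divr_ge0 ?mulr_ge0 ?sqr_ge0 // ltW.
  rewrite ler_wpM2l // ler_pM ?gradient_bound_ge0 ?invr_ge0 ?(ltW g0) //.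
  by rewrite lef_pV2 // posrE exprn_gt0.
rewrite /remainder_constant /remainder_factor [leRHS]mulrDl lerD //.
  have -> : K_factor ^+ 2 * X_factor * (T / (n%:R * s ^+ 2))
      = K_factor ^+ 2 * X_factor * (T / s ^+ 2) / n%:R by field; rewrite !gt_eqF.
  by rewrite ler_wpM2r // invr_ge0 ltW.
have -> : 5 * theta * L ^+ 2 * V_factor / mu ^+ 2 * (T / (n%:R * s ^+ 2))
    = 5 * theta * L ^+ 2 / (n%:R * mu ^+ 2) * (V_factor * (T / s ^+ 2)).
  by field; rewrite !gt_eqF.
rewrite [leLHS]mulrAC ler_wpM2l // divr_ge0 ?mulr_ge0 ?sqr_ge0 //; exact: ltW.
Qed.

End remainder.

(** * The run of the algorithm *)

Section dsgd_run.
Context {d : measure_display} {Omega : measurableType d} {R : realType} {n p m : nat}.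
Variable P : probability Omega R.
Variables (theta mu L sigma M : R) (f : 'I_n -> 'rV[R]_p -> R) (xs : 'rV[R]_p).
Variables (e : rel 'I_n) (W : 'M[R]_n).
Variables (g : 'I_n -> 'rV[R]_p -> 'rV[R]_m -> 'rV[R]_p).
Variables (z : nat -> 'I_n -> Omega -> 'rV[R]_m) (x0 : 'I_n -> 'rV[R]_p).
Hypotheses (theta_gt2 : 2 < theta) (mu_gt0 : 0 < mu) (L_gt0 : 0 < L) (M_gt0 : 0 < M).
Hypotheses (n_gt0 : (0 < n)%N) (p_gt0 : (0 < p)%N).
Hypothesis f_scs : forall i, strongly_convex_smooth mu L (f i).
Hypothesis xs_min : unique_minimizer (avg_objective f) xs.
Hypothesis W_mix : mixing_matrix e W.
Hypothesis rho_lt1 : rho W < 1.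
Hypothesis z_meas : forall k i, measurable_fun setT (z k i).
Hypothesis g_meas :
  forall i, measurable_fun setT (fun u : 'rV[R]_p * 'rV[R]_m => g i u.1 u.2).

Let alpha := stepsize theta mu L M.
Let x k i w := dsgd W alpha g x0 (fun l j => z l j w) k i.
Hypothesis noise : gradient_noise P sigma M f g x z.

Let grad k i w := gradient (f i) (x k i w).
Let N k i w := g i (x k i w) (z k i w) - grad k i w.

Let mu_le_L : mu <= L. Proof. exact: (strong_convexity_le_smoothness f_scs). Qed.

Let alpha_gt0 k : 0 < alpha k. Proof. exact: stepsize_gt0. Qed.

Let dsgd_next k i w : x k.+1 i w
  = \sum_j W i j *: (x k j w - alpha k *: g j (x k j w) (z k j w)).
Proof. by []. Qed.

(** The conditional means are those of measurable functions, so the stochastic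
    gradients at time [k] are measurable and the next iterates are as well. *)
Lemma measurable_iterates k i : measurable_fun setT (x k i).
Proof.
elim: k i => [|k IHk] i; first exact: measurable_cst.
apply: measurable_row_vector => c.
have -> : (fun w => x k.+1 i w 0 c) = (fun w =>
    \sum_j W i j * (x k j w 0 c - alpha k * g j (x k j w) (z k j w) 0 c)).
  apply/funext => w; rewrite dsgd_next summxE.
  by apply: eq_bigr => j _; rewrite !mxE.
apply: measurable_sum => j; apply: measurable_funM => //.
apply: measurable_funB.
  by apply: (measurableT_comp (measurable_coord c)).
apply: measurable_funM => //.
by case: (noise k) => _ /(_ j c) [[]].
Qed.

Let G k := history x k.
Let G_setT k : G k setT. Proof. exact: history_setT. Qed.
Let G_setI k : setI_closed (G k). Proof. exact: history_setI. Qed.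
Let G_measurable k : G k `<=` measurable.
Proof. by apply: history_measurable; exact: measurable_iterates. Qed.

Let adapted_iterate k i c : adapted (G k) (fun w => x k i w 0 c).
Proof.
move=> B mB; apply: (@history_iterate _ _ _ _ _ x k i ((fun u => u 0 c) @^-1` B)).
by have := measurable_coord c measurableT mB; rewrite setTI.
Qed.

Let adapted_gradient k i c : adapted (G k) (fun w => grad k i w 0 c).
Proof. by case: (noise k) => _ /(_ i c) []. Qed.

Let grad2 k : (forall i, vL2 P (x k i)) -> forall i, vL2 P (grad k i).
Proof.
move=> x2 i c.
have x2s : vL2 P (fun w => x k i w - xs) by apply: vL2B => //; exact: vL2_cst.
pose b w := 2 * L ^+ 2 * enorm (x k i w - xs) ^+ 2 + 2 * enorm (gradient (f i) xs) ^+ 2.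
have ib : L1 P b by apply: L1D; [apply: L1Z; exact: L1_enorm | exact: L1_cst].
apply: L2_le ib _; first exact: (adapted_measurable (@G_measurable k)).
move=> w; apply: (@le_trans _ _ (enorm (grad k i w) ^+ 2)).
  by rewrite enorm_sqrE (bigD1 c) //= lerDl; apply: sumr_ge0 => j _; exact: sqr_ge0.
have := enormD_sqr_le (grad k i w - gradient (f i) xs) (gradient (f i) xs) ltr01.
have := gradient_lipschitz f_scs i (x k i w) xs (ltW L_gt0).
by rewrite subrK invr1 /b -/(grad k i w); lra.
Qed.

Let moments k i : (forall i, vL2 P (x k i)) ->
  [/\ vL2 P (N k i),
      forall c, centered P (G k) (fun w => g i (x k i w) (z k i w) 0 c - grad k i w 0 c)
    & Enorm2 P (N k i) <= sigma ^+ 2 + M * Enorm2 P (grad k i)].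
Proof.
move=> x2; have [_ mean_g] := noise k => /(_ i) [V second_moment V_le].
exact: noise_moments (@G_setT k) (@G_setI k) (@G_measurable k) 
  (ltW M_gt0) (mean_g i) second_moment V_le (grad2 x2 i).
Qed.

(** Square-integrability and the bounds on the noise are proved together: the
    variance of the noise is finite at time [k] because the iterates at time [k]
    are square-integrable. *)
Lemma square_integrable_iterates k i : vL2 P (x k i).
Proof.
elim: k i => [|k IHk] i; first exact: vL2_cst.
rewrite (_ : x k.+1 i = fun w =>
  \sum_j W i j *: (x k j w - alpha k *: g j (x k j w) (z k j w))) //.
apply: vL2_sum => j; apply: vL2Z; apply: vL2B; [exact: IHk | apply: vL2Z].
have [N2 _ _] := moments j IHk; have := vL2D N2 (grad2 IHk j).
by under eq_fun do rewrite subrK.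
Qed.

Let x2 := square_integrable_iterates.

Let N2 k i : vL2 P (N k i). Proof. by case: (moments i (x2 k)). Qed.

Let N_var k i : Enorm2 P (N k i) <= sigma ^+ 2 + M * Enorm2 P (grad k i).
Proof. by case: (moments i (x2 k)). Qed.

Let N_centered k i c : centered P (G k) (fun w => N k i w 0 c).
Proof.
have [_ /(_ c) cN _] := moments i (x2 k); apply: centered_eq cN => w.
by rewrite /N !mxE.
Qed.

Let N_mean k i c : Ex P (fun w => N k i w 0 c) = 0.
Proof. by apply: (centered_Ex (G := G k)) => //; exact: N_centered. Qed.

Let adapted_uncorrelated k i (v : Omega -> 'rV[R]_p) : vL2 P v ->
  (forall c, adapted (G k) (fun w => v w 0 c)) -> uncorrelated P (N k i) v.
Proof.
move=> v2 Gv; split=> // c.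
rewrite (@eq_Ex _ _ _ P _ (fun w => N k i w 0 c * v w 0 c)); last first.
  by move=> w; rewrite mulrC.
apply: (centeredM (@G_measurable k) (N_centered k i c) (Gv c)).
exact: L2_mul (N2 k i c) (v2 c).
Qed.

Let NN k i j : i != j -> uncorrelated P (N k j) (N k i).
Proof.
move=> ij; split=> // c.
pose phi l (u : 'rV[R]_p * 'rV[R]_m) := g l u.1 u.2 0 c.
have phi2 l : L2 P (fun w => phi l (x k l w, z k l w)).
  have := L2D (N2 k l c) (grad2 (x2 k) l c).
  by under eq_fun do rewrite [X in X + _]mxE [X in _ + X + _]mxE subrK.
have mphi l : measurable_fun setT (phi l).
  by apply: (measurableT_comp (measurable_coord c)).
have Gx l A : measurable A -> G k (x k l @^-1` A) by exact: history_iterate.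
have [indep _ _] := noise k.
have cN : centered P (G k) (fun w => phi j (x k j w, z k j w) - grad k j w 0 c).
  by have [_ /(_ c)] := moments j (x2 k).
have := cond_independent_uncorrelated (@G_setT k) (@G_setI k) (@G_measurable k)
  (z_meas k) indep Gx mphi ij (adapted_gradient (k := k) i c) (adapted_gradient j c)
  (grad2 (x2 k) i c) (grad2 (x2 k) j c) (phi2 i) (phi2 j) cN.
by move=> <-; apply: eq_Ex => w; rewrite /N !mxE.
Qed.

Let xN k i j : uncorrelated P (N k i) (x k j).
Proof. exact: adapted_uncorrelated. Qed.

Let DN k i j : uncorrelated P (N k i) (grad k j).
Proof. by apply: adapted_uncorrelated => //; exact: grad2. Qed.

Let dsgd_succ k : x k.+1
  = fun i w => \sum_j W i j *: (x k j w - alpha k *: (grad k j w + N k j w)).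
Proof.
apply/funext => i; apply/funext => w; apply: eq_bigr => j _.
by rewrite /N [grad k j w + _]addrC subrK.
Qed.

Let A := Aconst x0 xs.
Let B := Bconst f xs.
Let K := Kconst theta mu L M.
Let K1 := K1const theta mu L M (rho W).
Let Xh := Xhat mu L sigma M n A B.

Let A_ge0 : 0 <= A. Proof. by apply: sumr_ge0 => i _; exact: sqr_ge0. Qed.
Let B_ge0 : 0 <= B. Proof. by apply: sumr_ge0 => i _; exact: sqr_ge0. Qed.
Let Xh_ge0 : 0 <= Xh. Proof. exact: Xhat_ge0. Qed.

Let dist k := total2 P (fun i w => x k i w - xs).
Let disag k := total2 P (fun i w => x k i w - average (x k ^~ w)).
Let meandist k := Enorm2 P (fun w => average (x k ^~ w) - xs).

Let dist_le k : dist k <= Xh.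
Proof.
apply: (@distance_recursion _ theta _ _ M) => //.
  by rewrite -[leRHS](Ex_cst P).
move=> {}k; rewrite /dist dsgd_succ.
exact: (total_distance_step xs mu_gt0 mu_le_L M_gt0 (alpha_gt0 k) f_scs W_mix
  (x2 k) (grad2 (x2 k)) (N2 k) (N_mean k) (N_var k) (xN k) (DN k)
  (stepsize_le theta_gt2 mu_gt0 L_gt0 M_gt0 k)).
Qed.

Let Vh := disagreement_constant theta mu L sigma M K1 n (rho W) Xh B.

Let K1_gt0 : 0 < K1%:R :> R.
Proof.
rewrite ltr0n (leq_trans _ (K1const_ge2K theta mu L M (rho W))) //.
by rewrite muln_gt0 Kconst_gt0.
Qed.

Let x2s k i : vL2 P (fun w => x k i w - xs).
Proof. by apply: vL2B => //; exact: vL2_cst. Qed.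

Let mean2 k : vL2 P (fun w => average (x k ^~ w)).
Proof. by apply: vL2Z; apply: vL2_sum. Qed.

Let disag_le_dist k : disag k <= dist k.
Proof.
apply: le_Ex.
- by apply: L1_total => i; apply: vL2B.
- by apply: L1_total.
by move=> w; exact: sum_deviation_le.
Qed.

Let meandist_le_dist k : meandist k <= dist k / n%:R.
Proof.
rewrite mulrC -ExZ; last by apply: L1_total.
apply: le_Ex.
- by apply: L1_enorm; apply: vL2B => //; exact: vL2_cst.
- by apply: L1Z; apply: L1_total.
by move=> w; rewrite -average_sub //; exact: enorm_average_le.
Qed.

Let disag_le k : (K1 - K <= k)%N -> disag k <= Vh / (k + K)%:R ^+ 2.
Proof.
have Q0 := gradient_bound_ge0 L sigma M_gt0 n Xh_ge0 B_ge0.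
apply: (disagreement_recursion theta_gt2 mu_gt0 L_gt0 M_gt0 (spectral_norm_ge0 _)
  rho_lt1 Q0).
- rewrite ler_pdivlMr ?exprn_gt0 // mulrC.
  apply: (@le_trans _ _ (K1%:R ^+ 2 * Xh)).
    by rewrite ler_wpM2l ?sqr_ge0 // (le_trans (disag_le_dist _)).
  rewrite /Vh /disagreement_constant lerDl.
  apply: divr_ge0; last exact: mulr_ge0 (sqr_ge0 _) (sqr_ge0 _).
  exact: mulr_ge0 (mulr_ge0 (ler0n _ _) (sqr_ge0 _)) Q0.
- by rewrite /Vh /disagreement_constant lerDr; exact: mulr_ge0 (sqr_ge0 _) Xh_ge0.
move=> {}k; rewrite /disag dsgd_succ.
exact: (disagreement_step (alpha k) mu_gt0 mu_le_L M_gt0 n_gt0 f_scs W_mix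
  (x2 k) (grad2 (x2 k)) (N2 k) (N_var k) (xN k) (DN k) rho_lt1 (dist_le k)).
Qed.

Lemma mean_distance_le k : (K1 - K <= k)%N ->
  Enorm2 P (fun w => average (x k ^~ w) - xs)
  <= theta ^+ 2 * c2 mu L sigma M n A B
       / ((3 / 2 * theta - 1) * n%:R * mu ^+ 2 * (k + K)%:R)
     + remainder_constant theta mu L sigma M K1 n (rho W) Xh B / (k + K)%:R ^+ 2.
Proof.
have Vh0 : 0 <= Vh by exact: disagreement_constant_ge0.
have c20 : 0 <= c2 mu L sigma M n A B.
  have nV : 0 <= n%:R^-1 :> R by rewrite invr_ge0.
  apply: addr_ge0.
    apply: mulr_ge0 Xh_ge0; apply: mulr_ge0 nV.
    exact: mulr_ge0 (mulr_ge0 (ler0n _ _) (ltW M_gt0)) (sqr_ge0 _).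
  apply: addr_ge0 (sqr_ge0 _); apply: mulr_ge0 nV.
  exact: mulr_ge0 (mulr_ge0 (ler0n _ _) (ltW M_gt0)) B_ge0.
move=> kK; apply: (mean_recursion (U := meandist) theta_gt2 mu_gt0 L_gt0 M_gt0 n_gt0
  c20 Vh0 mu_le_L _ _ disag_le _ kK).
- rewrite /remainder_constant lerDr; apply: divr_ge0 => //.
  exact: mulr_ge0 (sqr_ge0 _) Xh_ge0.
- rewrite ler_pdivlMr ?exprn_gt0 // mulrC.
  apply: (@le_trans _ _ (K1%:R ^+ 2 * Xh / n%:R)).
    rewrite -mulrA ler_wpM2l ?sqr_ge0 // (le_trans (meandist_le_dist _)) //.
    by rewrite ler_wpM2r // invr_ge0.
  rewrite /remainder_constant lerDl.
  apply: divr_ge0; last exact: mulr_ge0 (ler0n _ _) (sqr_ge0 _).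
  apply: mulr_ge0 Vh0; apply: mulr_ge0 (sqr_ge0 _).
  exact: mulr_ge0 (ler0n _ _) (ltW (lt_trans (ltr0n _ 2) theta_gt2)).
move=> {kK} {}k kK; rewrite /meandist dsgd_succ.
exact: (mean_step mu_gt0 mu_le_L M_gt0 (alpha_gt0 k) n_gt0 f_scs W_mix
  (x2 k) (grad2 (x2 k)) (N2 k) (N_mean k) (N_var k) (xN k) (DN k) (NN k)
  (stepsize_le_late theta_gt2 mu_gt0 L_gt0 M_gt0 kK)
  (average_gradient_at_min f_scs xs_min) erefl (dist_le k)).
Qed.

Lemma expectation_mean k :
  'E_P[fun w => (enorm (average (x k ^~ w) - xs) ^+ 2)%R]%E
  = (Enorm2 P (fun w => average (x k ^~ w) - xs))%:E.
Proof.
rewrite unlock integral_Ex //.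
by apply: L1_enorm; apply: vL2B => //; exact: vL2_cst.
Qed.

End dsgd_run.

Theorem corollary1 (R : realType) (theta mu L sigma M : R)
    (theta_gt2 : 2 < theta) (mu_gt0 : 0 < mu) (L_gt0 : 0 < L)
    (sigma_gt0 : 0 < sigma) (M_gt0 : 0 < M) :
  exists C : R,
  forall (n p m : nat) (d : measure_display) (Omega : measurableType d)
    (P : probability Omega R)
    (f : 'I_n -> 'rV[R]_p -> R) (xs : 'rV[R]_p)
    (e : rel 'I_n) (W : 'M[R]_n)
    (g : 'I_n -> 'rV[R]_p -> 'rV[R]_m -> 'rV[R]_p)
    (xi : nat -> 'I_n -> {RV P >-> 'rV[R]_m}) (x0 : 'I_n -> 'rV[R]_p),
  let x k i w :=
    dsgd W (stepsize theta mu L M) g x0 (fun l j => xi l j w) k i in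
  let K := Kconst theta mu L M in
  let K1 := K1const theta mu L M (rho W) in
  let A := Aconst x0 xs in
  let B := Bconst f xs in
  (0 < n)%N -> (0 < p)%N -> (0 < m)%N ->
  (forall i, strongly_convex_smooth mu L (f i)) ->
  unique_minimizer (avg_objective f) xs ->
  connected_graph e ->
  mixing_matrix e W ->
  rho W < 1 ->
  (forall i, measurable_fun setT (fun u : 'rV[R]_p * 'rV[R]_m => g i u.1 u.2)) ->
  gradient_noise P sigma M f g x xi ->
  exists2 c : R, `|c| <= C * ((A + B + n%:R) / (n%:R * (1 - rho W) ^+ 2))
  & forall k : nat, (K1 - K <= k)%N ->
      ('E_P[fun w => (enorm (average (fun i => x k i w) - xs) ^+ 2)%R] <=
       (theta ^+ 2 * c2 mu L sigma M n A B
          / ((3 / 2 * theta - 1) * n%:R * mu ^+ 2 * (k + K)%:R)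
        + c / (k + K)%:R ^+ 2)%R%:E)%E.
Proof.
exists (remainder_factor theta mu L sigma M).
move=> n p m d Omega P f xs e W g xi x0 x K K1 A B n0 p0 _ f_scs xs_min _ W_mix.
move=> rho1 g_meas noise; have xi_meas k i : measurable_fun setT (xi k i) by [].
have A0 : 0 <= A by apply: sumr_ge0 => i _; exact: sqr_ge0.
have B0 : 0 <= B by apply: sumr_ge0 => i _; exact: sqr_ge0.
exists (remainder_constant theta mu L sigma M K1 n (rho W)
  (Xhat mu L sigma M n A B) B).
  rewrite ger0_norm; first exact: remainder_constant_le (spectral_norm_ge0 _) rho1.
  by apply: remainder_constant_ge0 => //; exact: Xhat_ge0.
move=> k kK; rewrite (expectation_mean xs L_gt0 M_gt0 f_scs noise) lee_fin.
exact: (mean_distance_le theta_gt2 mu_gt0 L_gt0 M_gt0 n0 p0 f_scs xs_min W_mix rho1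
  xi_meas g_meas noise kK).
Qed.
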